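(* For every $r\in\mathbb{N}$ with $r\ge 3$ there exists $\mu>0$ such that the following holds for all sufficiently large $n$ with $n\equiv 1,3\pmod 6$. For every $r$-edge-colouring of $K_n^{(3)}$ there is a Steiner triple system of order $n$ with at least $\frac{1}{r}\cdot\frac{1}{3}\binom{n}{2}+\mu n^2$ edges of the same colour.
   Context: $[n]=\{1,\dots,n\}$. $K_n^{(3)}$ is the complete $3$-uniform hypergraph on vertex set $[n]$, whose edges are all $3$-subsets (triples) of $[n]$. An $r$-edge-colouring of $K_n^{(3)}$ is an arbitrary map from the set of triples of $[n]$ to a set of $r$ colours. A Steiner triple system of order $n$ is a set $\mathcal{S}$ of $3$-subsets of $[n]$ such that every $2$-subset of $[n]$ is contained in exactly one of the triples of $\mathcal{S}$; its triples are called its edges. *)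

(* Defs.v *)
From mathcomp Require Import all_boot all_order all_algebra.
From mathcomp Require Import reals.

Set Implicit Arguments.
Unset Strict Implicit.
Unset Printing Implicit Defensive.

(* The vertex set [n] = {1, ..., n} is represented by 'I_n = {0, ..., n-1}. *)
Notation triple n := {T : {set 'I_n} | #|T| == 3}.

Definition steiner_triple_system (n : nat) (S : {set triple n}) : Prop :=
  forall P : {set 'I_n}, #|P| = 2 ->
    exists! T : triple n, T \in S /\ P \subset val T.

(* Main.v *)
Require Import Defs.
From mathcomp Require Import all_boot all_order all_algebra.
From mathcomp Require Import fingroup perm action primitive_action alt.
From mathcomp Require Import reals.
From mathcomp Require Import zify ring.

Set Implicit Arguments.
Unset Strict Implicit.
Unset Printing Implicit Defensive.

Import GRing.Theory.

(** Call a triple system nearly balanced when every colour has about its share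
1/r of the triples. A system that is not nearly balanced has one colour well
above its share, so suppose that all systems on [n] are nearly balanced.

Local moves. The triples of an octahedron with antipodal pairs {a, x}, {b, y},
{c, z} split into two halves, abc, ayz, xbz, xyc and xbc, xyz, abz, ayc, which
cover the same pairs. A system containing the first half (a Pasch configuration)
remains one when it is replaced by the second. If the halves do not carry the
same multiset of colours, some colour gains from this switch. There are systems
with a quadratic number of pairwise disjoint Pasch configurations
([grid_exists], [grid_switchable]). If a positive proportion of all octahedra
is unbalanced in this sense, then after a suitable relabelling of the points a
quadratic number of these switches gains ([good_relabelling]); quadratically
many of them gain for one and the same colour, and performing these
([switch_all]) lifts a colour that had about its share well above it.

Unbalanced octahedra. Averaging near balance over all relabellings shows that
every colour has positive density among all triples ([dense_colours]), so it
remains to see that three dense colours force a positive density of unbalanced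
octahedra ([many_unbalanced]). A random sample of boundedly many points contains,
with probability bounded below, three claws of each of the three colours; a claw
consists of xyz together with three triples each differing from it in one vertex.
If all octahedra in the sample were balanced, take in the sample three
points a, b, c which all other sample points treat alike, by Ramsey's theorem. The
octahedra with antipodal pairs {x, a}, {y, b}, {z, c} then express the colour of
xyz through colours O, H(x) and G(xy) of the triples meeting {a, b, c} in three,
two and one points. For a colour i other than O every claw of colour i has a
vertex with H = i ([claw_vertex]), and two different such colours cannot both
supply such vertices ([no_two_dominant]). With three colours, two differ from O,
a contradiction. With two colours there is none: the colouring that records
whether a triple is contained in one part of a bipartition is balanced on every
octahedron. *)

(** * Steiner triple systems and switching octahedra *)

Lemma uniq6E (V : eqType) (a x b y c z : V) : uniq [:: a; x; b; y; c; z] ->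
  ((a == x) = false) * ((x == a) = false) * ((a == b) = false) * ((b == a) = false) *
  ((a == y) = false) * ((y == a) = false) * ((a == c) = false) * ((c == a) = false) *
  ((a == z) = false) * ((z == a) = false) * ((x == b) = false) * ((b == x) = false) *
  ((x == y) = false) * ((y == x) = false) * ((x == c) = false) * ((c == x) = false) *
  ((x == z) = false) * ((z == x) = false) * ((b == y) = false) * ((y == b) = false) *
  ((b == c) = false) * ((c == b) = false) * ((b == z) = false) * ((z == b) = false) *
  ((y == c) = false) * ((c == y) = false) * ((y == z) = false) * ((z == y) = false) *
  ((c == z) = false) * ((z == c) = false).
Proof.
by move=> h; do ?split; apply/eqP => e; move: h; rewrite e /= !inE eqxx ?orbT ?andbF.
Qed.

Section Switching.
Variable V : finType.
Implicit Types (o : 6.-tuple V) (S : {set {set V}}) (T : {set V}) (L : seq (6.-tuple V)).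

(** Counting the triples through a pair, rather than asserting existence and
uniqueness, makes the effect of a switch a computation with sums. *)
Definition sts S :=
  (forall T, T \in S -> #|T| = 3) /\
  (forall p q, p != q -> \sum_(T in S) ((p \in T) && (q \in T)) = 1).

Lemma sts_uniq S T T' p q :
  sts S -> p != q -> T \in S -> T' \in S -> p \in T -> q \in T -> p \in T' -> q \in T' ->
  T = T'.
Proof.
move=> [_ hS] /hS hpq TS TS' pT qT pT' qT'.
apply/eqP/negPn/negP => neqT.
move: hpq; rewrite (bigD1 T) //= (bigD1 T') /=; last by rewrite TS' eq_sym.
by rewrite pT qT pT' qT'.
Qed.

(** An octahedron is the tuple of its vertices with antipodal ones adjacent:
[tuple a; x; b; y; c; z] has antipodal pairs {a, x}, {b, y}, {c, z}. The faces
with an odd number of vertices among a, b, c are the positive ones. *)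
Definition positives (o : 6.-tuple V) : seq {set V} :=
  if val o is [:: a; x; b; y; c; z] then
    [:: [set a; b; c]; [set a; y; z]; [set x; b; z]; [set x; y; c]]
  else [::].

Definition negatives (o : 6.-tuple V) : seq {set V} :=
  if val o is [:: a; x; b; y; c; z] then
    [:: [set x; b; c]; [set x; y; z]; [set a; b; z]; [set a; y; c]]
  else [::].

Lemma sum_exchange (I : finType) (S : {set I}) (P N : seq I) (w : I -> nat) :
  uniq P -> uniq N -> {subset P <= S} -> (forall t, t \in N -> t \notin S) ->
  \sum_(t in [set t in S | t \notin P] :|: [set t in N]) w t + \sum_(t <- P) w t =
  \sum_(t in S) w t + \sum_(t <- N) w t.
Proof.
move=> uP uN sP dN; rewrite !big_uniq //=.
rewrite (eq_bigl [predU [pred t in S | t \notin P] & N]); last first.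
  by move=> t; rewrite !inE.
rewrite bigU /=; last first.
  rewrite disjoint_sym disjoint_subset; apply/subsetP => t.
  by rewrite !inE => /dN /negPf ->.
rewrite (bigID (mem P) (mem S)) /= [in RHS]addnC addnA [RHS]addnC addnA; congr (_ + _ + _).
by apply: eq_bigl => t; case: (boolP (t \in P)) => [/sP ->|]; rewrite ?andbF.
Qed.

Definition switch S o : {set {set V}} :=
  [set T in S | T \notin positives o] :|: [set T in negatives o].

Lemma tuple6P (P : 6.-tuple V -> Prop) :
  (forall a x b y c z, P [tuple a; x; b; y; c; z]) -> forall o, P o.
Proof.
move=> h [[|a [|x [|b [|y [|c [|z [|? ?]]]]]]] //= sz].
by have := h a x b y c z; congr (P _); apply: val_inj.
Qed.

Lemma positivesE a x b y c z : positives [tuple a; x; b; y; c; z] =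
  [:: [set a; b; c]; [set a; y; z]; [set x; b; z]; [set x; y; c]].
Proof. by []. Qed.

Lemma negativesE a x b y c z : negatives [tuple a; x; b; y; c; z] =
  [:: [set x; b; c]; [set x; y; z]; [set a; b; z]; [set a; y; c]].
Proof. by []. Qed.

(** The switch is an exchange of disjoint families: a negative triple in S would
share a pair with a positive one. *)
Lemma switch_sum S o (w : {set V} -> nat) :
  sts S -> uniq o -> {subset positives o <= S} ->
  \sum_(T in switch S o) w T + \sum_(T <- positives o) w T =
  \sum_(T in S) w T + \sum_(T <- negatives o) w T.
Proof.
move: o; apply: tuple6P => a x b y c z hS /uniq6E ne sub.
have up : uniq (positives [tuple a; x; b; y; c; z]).
  rewrite positivesE /= !inE !negb_or !andbT.
  by apply/and3P; split; [apply/and3P; split|apply/andP; split|];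
    apply/eqP => /setP e; move: (e a) (e b) (e c) (e z); rewrite !inE !eqxx !ne.
have un : uniq (negatives [tuple a; x; b; y; c; z]).
  rewrite negativesE /= !inE !negb_or !andbT.
  by apply/and3P; split; [apply/and3P; split|apply/andP; split|];
    apply/eqP => /setP e; move: (e x) (e b) (e c) (e z); rewrite !inE !eqxx !ne.
have key p q u T : T \in positives [tuple a; x; b; y; c; z] -> p \in T -> q \in T ->
    p != q -> u \notin T -> [set u; p; q] \notin S.
  move=> Tp pT qT npq uT; apply/negP => uS.
  have eT : T = [set u; p; q] by apply: sts_uniq npq (sub _ Tp) uS pT qT _ _; rewrite ?inE ?eqxx ?orbT.
  by move: uT; rewrite eT !inE eqxx.
have dis T : T \in negatives [tuple a; x; b; y; c; z] -> T \notin S.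
  rewrite negativesE !inE => /or4P[] /eqP ->.
  - by apply: (key b c x [set a; b; c]); rewrite ?inE ?eqxx ?orbT ?ne.
  - by apply: (key y z x [set a; y; z]); rewrite ?inE ?eqxx ?orbT ?ne.
  - by apply: (key b z a [set x; b; z]); rewrite ?inE ?eqxx ?orbT ?ne.
  - by apply: (key y c a [set x; y; c]); rewrite ?inE ?eqxx ?orbT ?ne.
by apply: sum_exchange.
Qed.

Lemma set3_sum (p a b c : V) : uniq [:: a; b; c] ->
  (p \in [set a; b; c]) = (p == a) + (p == b) + (p == c) :> nat.
Proof.
rewrite /= !inE negb_or => /and3P[/andP[/eqP ab /eqP ac] /eqP bc _].
by case: (p =P a) => [->|_]; case: (_ =P b) => [?|_] //=; case: (_ =P c) => // ?; congruence.
Qed.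

(** Both halves of an octahedron cover the same pairs: for p <> q, expanding
membership of p and q in each triple leaves, on either side, every non-antipodal
pair of the six vertices once. *)
Lemma octahedron_cover o p q : uniq o -> p != q ->
  \sum_(T <- positives o) ((p \in T) && (q \in T)) =
  \sum_(T <- negatives o) ((p \in T) && (q \in T)).
Proof.
move: o; apply: tuple6P => a x b y c z /uniq6E ne npq.
rewrite positivesE negativesE !big_cons !big_nil -!mulnb.
by rewrite !set3_sum /= ?inE ?ne //; ring.
Qed.

Lemma switch_sts S o : sts S -> uniq o -> {subset positives o <= S} -> sts (switch S o).
Proof.
move=> hS uo sub; split=> [T|p q npq].
  rewrite in_setU !in_set => /orP[/andP[/hS.1 //]|].
  move: o uo {sub}; apply: tuple6P => a x b y c z /uniq6E ne.
  by rewrite negativesE !inE => /or4P[] /eqP ->;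
    rewrite -setUA !cardsU1 cards1 !inE !ne.
have := switch_sum (fun T => (p \in T) && (q \in T)) hS uo sub.
by rewrite (octahedron_cover uo npq) hS.2 // => /addIn.
Qed.

(** Switching removes only the positive triples of one octahedron, so the
others remain available for switching. *)
Lemma switch_all (w : {set V} -> nat) L S :
  sts S -> uniq L ->
  (forall o, o \in L -> uniq o /\ {subset positives o <= S}) ->
  (forall o o' T, o \in L -> o' \in L -> T \in positives o -> T \in positives o' -> o = o') ->
  (forall o, o \in L ->
    \sum_(T <- positives o) w T < \sum_(T <- negatives o) w T) ->
  exists2 S', sts S' & \sum_(T in S) w T + size L <= \sum_(T in S') w T.
Proof.
elim: L S => [|o L IH] S hS; first by exists S; rewrite // addn0.
move=> /= /andP[oL uL] hL dis gain.
have [uo sub] := hL _ (mem_head _ _).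
have := switch_sum w hS uo sub; have := gain _ (mem_head _ _).
have [|||S' hS'] := IH (switch S o) (switch_sts hS uo sub) uL.
- move=> o' o'L; have o'oL : o' \in o :: L by rewrite inE o'L orbT.
  have [uo' sub'] := hL _ o'oL; split=> // T To'; rewrite in_setU !in_set (sub' _ To') /=.
  case: (boolP (T \in positives o)) => //= To.
  by rewrite (dis _ _ _ (mem_head _ _) o'oL To To') o'L in oL.
- by move=> o1 o2 T h1 h2; apply: dis; rewrite inE ?h1 ?h2 orbT.
- by move=> o' h; apply: gain; rewrite inE h orbT.
move=> h1 h2 h3; exists S' => //; move: h1 h2 h3.
move: (\sum_(T in S) w T) (\sum_(T in S') w T) (\sum_(T in switch S o) w T) => A B C.
by move: (\sum_(T <- _) w T) (\sum_(T <- _) w T) => D E; lia.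
Qed.

Lemma sts_card S : sts S -> 6 * #|S| = #|V| * #|V|.-1.
Proof.
move=> hS.
have -> : #|V| * #|V|.-1 = \sum_(p : V) \sum_(q | p != q) 1.
  rewrite -sum_nat_const; apply: eq_bigr => p _.
  rewrite sum1_card cardE -(cardC1 p) cardE; congr size.
  by apply: eq_enum => q; rewrite !inE eq_sym.
under eq_bigr => p _ do
  (under eq_bigr => q npq do rewrite -(hS.2 p q npq); rewrite exchange_big /=).
rewrite exchange_big /= mulnC -sum_nat_const; apply: eq_bigr => T TS.
have cT := hS.1 _ TS.
rewrite (bigID (mem T)) /= [X in _ = _ + X]big1 ?addn0 => [|p /negPf pT]; last first.
  by rewrite big1 // => q _; rewrite pT.
rewrite (eq_bigr (fun=> 2)) ?sum_nat_const ?cT // => p pT.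
under eq_bigr => q _ do rewrite pT /=.
have <- : #|T :\ p| = 2 by move: (cardsD1 p T); rewrite pT cT => -[].
rewrite -sum1_card big_mkcond [RHS]big_mkcond /=; apply: eq_bigr => q _.
by rewrite !inE eq_sym; case: eqP => //= _; case: (_ \in _).
Qed.

End Switching.

(** * Averaging over permutations of the points *)

Section Averaging.
Variable V : finType.

Lemma perm_tuple k (t t' : k.-tuple V) :
  uniq t -> uniq t' -> exists s : {perm V}, map_tuple s t = t'.
Proof.
move=> ut ut'.
have kV : k <= #|V| by rewrite -(size_tuple t) -(card_uniqP ut) max_card.
have tr := ntransitive_weak kV (Sym_trans V).
have dt (u : k.-tuple V) : uniq u -> u \in k.-dtuple([set: V]).
  by move=> uu; rewrite inE uu; apply/subsetP => x _; rewrite inE.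
have [s _ ->] := atransP2 tr (dt _ ut) (dt _ ut').
by exists s; apply: val_inj => /=; apply: eq_map => x; rewrite /= apermE.
Qed.

(** The symmetric group is transitive on k-tuples of distinct points, so the
average of g over the orbit of t0 is the average over all of them. *)
Lemma averaging k (g : k.-tuple V -> nat) (t0 : k.-tuple V) : uniq t0 ->
  #|[set t : k.-tuple V | uniq t]| * \sum_(s : {perm V}) g (map_tuple s t0) =
  #|{perm V}| * \sum_(t : k.-tuple V | uniq t) g t.
Proof.
move=> u0; have -> : #|{perm V}| * \sum_(t : k.-tuple V | uniq t) g t =
    \sum_(s : {perm V}) \sum_(t : k.-tuple V | uniq t) g (map_tuple s t).
  rewrite -sum_nat_const; apply: eq_bigr => s _.
  have inj : injective (map_tuple s : k.-tuple V -> k.-tuple V).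
    by move=> t t' /(congr1 val) /= /(inj_map (@perm_inj _ s)) /val_inj.
  rewrite (reindex_inj inj); apply: eq_bigl => t /=.
  by rewrite map_inj_uniq //; apply: perm_inj.
rewrite exchange_big /= -sum_nat_const [LHS]big_mkcond [RHS]big_mkcond /=.
apply: eq_bigr => t _; rewrite inE; case: ifP => // ut.
have [s st] := perm_tuple u0 ut.
rewrite (reindex_inj (mulgI s)); apply: eq_bigr => p _; congr g.
by rewrite -st; apply: val_inj => /=; rewrite -map_comp; apply: eq_map => x; rewrite permM.
Qed.

Lemma leq_card_uniq_tuples k : #|[set t : k.-tuple V | uniq t]| <= #|V| ^ k.
Proof. by rewrite -card_tuple max_card. Qed.

(** Under a uniform random relabelling each member of L is a uniform tuple of
distinct points, so the expected number of hits of B is at least |L| |B| / |V|^k;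
some relabelling reaches the expectation. *)
Lemma good_relabelling k (L : seq (k.-tuple V)) (B : {set k.-tuple V}) :
  (forall t, t \in L -> uniq t) -> (forall t, t \in B -> uniq t) ->
  exists s : {perm V},
    size L * #|B| <= count (fun t => map_tuple s t \in B) L * #|V| ^ k.
Proof.
move=> uL uB; set u := #|[set t : k.-tuple V | uniq t]|.
pose h (s : {perm V}) := count (fun t => map_tuple s t \in B) L.
have avg : u * \sum_s h s = #|{perm V}| * (size L * #|B|).
  have hE s : h s = \sum_(t <- L) (map_tuple s t \in B).
    by rewrite /h -sum1_count [LHS]big_mkcond /=; apply: eq_bigr => t _; case: (_ \in _).
  under eq_bigr do rewrite hE.
  rewrite exchange_big /= big_distrr /=.
  rewrite big_seq (eq_bigr (fun=> #|{perm V}| * #|B|)); last first.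
    move=> t tL; rewrite (averaging (fun t => t \in B : nat) (uL _ tL)).
    congr (_ * _); rewrite -sum1_card [LHS]big_mkcond [RHS]big_mkcond /=.
    by apply: eq_bigr => t' _; case: (boolP (t' \in B)) => [/uB ->|]; rewrite ?if_same.
  by rewrite -big_seq big_const_seq count_predT iter_addn_0 mulnAC -mulnA.
have [s _ hs] : exists2 s, true & forall s', h s' <= h s.
  by case: (arg_maxnP h (P := predT) (i0 := 1%g)) => // s _ hs; exists s => // s'; apply: hs.
exists s; rewrite -/(h s).
have cP : 0 < #|{perm V}| by apply/card_gt0P; exists 1%g.
rewrite -(leq_pmul2l cP) -avg.
have h1 : \sum_s' h s' <= #|{perm V}| * h s.
  by rewrite -sum_nat_const; apply: leq_sum.
apply: leq_trans (leq_mul (leq_card_uniq_tuples k) h1) _.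
by rewrite mulnC -mulnA.
Qed.

(** The average of the sums over all relabellings is |S| times the proportion of
triples with P. *)
Lemma colour_density (S : {set {set V}}) (P : {set V} -> bool) d :
  (forall T, T \in S -> #|T| = 3) -> 0 < #|S| ->
  (forall s : {perm V}, #|S| <= d * \sum_(T in S) P [set s x | x in T]) ->
  #|[set t : 3.-tuple V | uniq t]| <=
  d * #|[set t : 3.-tuple V | uniq t & P [set x in t]]|.
Proof.
move=> cS S0 hS; set u := #|[set t : 3.-tuple V | uniq t]|.
set N := #|[set t : 3.-tuple V | uniq t & P [set x in t]]|.
have cP : 0 < #|{perm V}| by apply/card_gt0P; exists 1%g.
have avg T : T \in S ->
    u * \sum_(s : {perm V}) P [set s x | x in T] = #|{perm V}| * N.
  move=> /cS cT; have szT : size (enum T) == 3 by rewrite -cardE cT.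
  pose t0 := Tuple szT; have u0 : uniq t0 by apply: enum_uniq.
  have := averaging (fun t => P [set x in t] : nat) u0.
  have -> : \sum_(t : 3.-tuple V | uniq t) P [set x in t] = N.
    rewrite /N -sum1_card [LHS]big_mkcond [RHS]big_mkcond /=.
    by apply: eq_bigr => t _; rewrite inE; case: (uniq t); case: (P _).
  move=> <-; congr (_ * _); apply: eq_bigr => s _; congr (nat_of_bool (P _)).
  apply/setP => x; rewrite inE; apply/imsetP/mapP => -[y yT ->]; exists y => //.
    by rewrite mem_enum.
  by rewrite mem_enum in yT.
have tot : u * \sum_(s : {perm V}) \sum_(T in S) P [set s x | x in T] =
    #|S| * (#|{perm V}| * N).
  rewrite exchange_big /= big_distrr /= -sum_nat_const.
  by apply: eq_bigr => T /avg.
have low : #|{perm V}| * #|S| <=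
    d * \sum_(s : {perm V}) \sum_(T in S) P [set s x | x in T].
  by rewrite -sum_nat_const big_distrr /=; apply: leq_sum.
rewrite -(leq_pmul2l (_ : 0 < #|S| * #|{perm V}|)) ?muln_gt0 ?S0 //.
have := leq_mul (leqnn u) low; rewrite [u * (d * _)]mulnCA tot.
move: #|{perm V}| #|S| (u) (N) => A B u' N' h.
have -> : B * A * u' = u' * (A * B) by ring.
by have -> : B * A * (d * N') = d * (B * (A * N')) by ring.
Qed.

End Averaging.

(** * A Ramsey lemma *)

Section Ramsey.

Lemma not_pairwise (T : eqType) (r : rel T) (s : seq T) :
  ~~ pairwise r s -> exists b c, subseq [:: b; c] s /\ ~~ r b c.
Proof.
elim: s => //= x s IH; rewrite negb_and => /orP[|/IH[b [c [bcs rbc]]]].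
  rewrite -has_predC => /hasP[c cs rxc]; exists x, c; split=> //.
  by rewrite /= eqxx sub1seq.
exists b, c; split=> //; case: eqP => // _.
by apply: subseq_trans bcs; apply: subseq_cons.
Qed.

(** Induction on the number of available colours: the first vertex has many
later neighbours in one colour, and that colour either closes a triangle or does
not occur among these neighbours. *)
Lemma triangle_ramsey_aux (C : finType) m : exists N, forall (D : {set C}) (T : eqType)
    (e : T -> T -> C) (s : seq T),
  #|D| <= m -> N <= size s -> pairwise (fun x y => e x y \in D) s ->
  exists a b c, [/\ subseq [:: a; b; c] s, e a b = e a c & e a b = e b c].
Proof.
elim: m => [|m [N IH]].
  exists 2 => D T e [|a [|b s]] //=; rewrite leqn0 cards_eq0 => /eqP -> _.
  by rewrite inE.
exists (m.+1 * N + 2) => D T e s cD.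
case: s => [|a s]; first by rewrite addn2.
rewrite /= addn2 ltnS => szs /andP[aD pD].
pose cl d := [seq x <- s | e a x == d].
have [d dD szd] : exists2 d, d \in D & N <= size (cl d).
  case: (boolP [exists d in D, N <= size (cl d)]) => [/exists_inP //|].
  rewrite negb_exists => /forallP small.
  have : size s <= #|D| * N.
    rewrite -sum_nat_const -(count_predT s).
    apply: leq_trans (_ : \sum_(d in D) size (cl d) <= _); last first.
      by apply: leq_sum => d dD; have := small d; rewrite dD -ltnNge => /ltnW.
    under eq_bigr do rewrite size_filter -sum1_count big_mkcond.
    rewrite exchange_big /= -sum1_count big_seq_cond [X in _ <= X]big_seq_cond.
    apply: leq_sum => x /andP[xs _].
    by rewrite (bigD1 (e a x)) ?eqxx //=; apply: (allP aD).
  by move: cD szs; move: (size s) => ss; nia.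
have sub : subseq (cl d) s by apply: filter_subseq.
have ecl x : x \in cl d -> e a x = d by rewrite mem_filter => /andP[/eqP].
case: (boolP (pairwise (fun x y => e x y != d) (cl d))) => [nd|].
  have cD' : #|D :\ d| <= m by move: cD; rewrite (cardsD1 d) dD.
  have [|b [c [f [bcf e1 e2]]]] := IH _ _ e (cl d) cD' szd.
    have : pairwise [rel x y | (e x y != d) && (e x y \in D)] (cl d).
      by rewrite pairwise_relI nd (subseq_pairwise sub pD).
    by apply: sub_pairwise => x y /=; rewrite !inE.
  exists b, c, f; split=> //.
  apply: subseq_trans bcf (subseq_trans sub (subseq_cons _ _)).
move=> /not_pairwise[b [c [bc /negPn/eqP ebc]]].
have bin : b \in cl d by apply: (mem_subseq bc); rewrite inE eqxx.
have cin : c \in cl d by apply: (mem_subseq bc); rewrite !inE eqxx orbT.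
exists a, b, c; rewrite (ecl b) ?(ecl c) // ebc; split=> //.
by rewrite /= eqxx; apply: subseq_trans bc sub.
Qed.

Lemma triangle_ramsey (C : finType) : exists N, forall e : 'I_N -> 'I_N -> C,
  exists a b c, [/\ uniq [:: a; b; c], e a b = e a c & e a b = e b c].
Proof.
have [N hN] := triangle_ramsey_aux C #|C|; exists N => e.
have [|||a [b [c [abc e1 e2]]]] := hN setT _ e (enum 'I_N).
- by rewrite max_card.
- by rewrite size_enum_ord.
- by elim: (enum _) => //= x s' ->; rewrite andbT; apply/allP => y _; rewrite inE.
by exists a, b, c; rewrite (subseq_uniq abc) ?enum_uniq.
Qed.

End Ramsey.

(** * Balanced colourings have a dominant colour *)

(** In the application a, b, c are three points that all points of B treat alike;
F is the colour of xyz, G that of a triple xya, H that of xab, and O that of abc.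
The hypothesis balance says that the octahedron with antipodal pairs {x, a},
{y, b}, {z, c} is balanced. *)
Section Dominant.
Variables (V C : eqType) (B : pred V).
Variables (F : V -> V -> V -> C) (G : V -> V -> C) (H : V -> C) (O : C).
Hypothesis Gsym : forall x y, G x y = G y x.
Hypothesis balance : forall x y z i, x \in B -> y \in B -> z \in B ->
  uniq [:: x; y; z] ->
  (F x y z == i) + (H x == i) + (H y == i) + (H z == i) =
  (O == i) + (G x y == i) + (G x z == i) + (G y z == i).

(** Otherwise a triple of the six vertices contains one pair with G = i if its
colour is i, and none if not. So these pairs are disjoint. If xy is the one in
xyz, then x'yz and xy'z must contain x'z and y'z, which meet in z; the other two
cases are alike. *)
Lemma claw_vertex i x y z x' y' z' :
  all (mem B) [:: x; y; z; x'; y'; z'] -> uniq [:: x; y; z; x'; y'; z'] -> i != O ->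
  F x y z = i -> F x' y z = i -> F x y' z = i -> F x y z' = i ->
  has (fun v => H v == i) [:: x; y; z; x'; y'; z'].
Proof.
move=> /and5P[/= Bx By Bz Bx' /and3P[By' Bz' _]] /uniq6E ne iO F1 F2 F3 F4.
apply/negPn/negP; rewrite /= !negb_or !andbT.
move=> /and5P[/negPf Hx /negPf Hy /negPf Hz /negPf Hx' /andP[/negPf Hy' /negPf Hz']].
have Oi : (O == i) = false by rewrite eq_sym (negPf iO).
have tri p q u : p \in B -> q \in B -> u \in B -> uniq [:: p; q; u] ->
    H p == i = false -> H q == i = false -> H u == i = false ->
    (F p q u == i : nat) = (G p q == i) + (G p u == i) + (G q u == i).
  by move=> Bp Bq Bu un Hp Hq Hu; have := balance i Bp Bq Bu un; rewrite Hp Hq Hu Oi !addn0.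
have le p q u : p \in B -> q \in B -> u \in B -> uniq [:: p; q; u] ->
    H p == i = false -> H q == i = false -> H u == i = false ->
    (G p q == i) + (G p u == i) <= 1.
  move=> Bp Bq Bu un Hp Hq Hu; have := tri p q u Bp Bq Bu un Hp Hq Hu.
  by case: (F _ _ _ == i); case: (G p q == i); case: (G p u == i).
have t1 := tri x y z Bx By Bz ltac:(by rewrite /= !inE !ne) Hx Hy Hz.
have t2 := tri x' y z Bx' By Bz ltac:(by rewrite /= !inE !ne) Hx' Hy Hz.
have t3 := tri x y' z Bx By' Bz ltac:(by rewrite /= !inE !ne) Hx Hy' Hz.
have t4 := tri x y z' Bx By Bz' ltac:(by rewrite /= !inE !ne) Hx Hy Hz'.
have n1 := le x y y' Bx By By' ltac:(by rewrite /= !inE !ne) Hx Hy Hy'.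
have n2 := le x z z' Bx Bz Bz' ltac:(by rewrite /= !inE !ne) Hx Hz Hz'.
have n3 := le x y' z' Bx By' Bz' ltac:(by rewrite /= !inE !ne) Hx Hy' Hz'.
have n4 := le y x x' By Bx Bx' ltac:(by rewrite /= !inE !ne) Hy Hx Hx'.
have n5 := le y z z' By Bz Bz' ltac:(by rewrite /= !inE !ne) Hy Hz Hz'.
have n6 := le y x' z' By Bx' Bz' ltac:(by rewrite /= !inE !ne) Hy Hx' Hz'.
have n7 := le z x x' Bz Bx Bx' ltac:(by rewrite /= !inE !ne) Hz Hx Hx'.
have n8 := le z y y' Bz By By' ltac:(by rewrite /= !inE !ne) Hz Hy Hy'.
have n9 := le z x' y' Bz Bx' By' ltac:(by rewrite /= !inE !ne) Hz Hx' Hy'.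
move: t1 t2 t3 t4 n1 n2 n3 n4 n5 n6 n7 n8 n9.
rewrite F1 F2 F3 F4 eqxx [G y x]Gsym [G z x]Gsym [G z y]Gsym [G y x']Gsym.
rewrite [G z x']Gsym [G z y']Gsym.
case: (G x y == i); case: (G x z == i); case: (G y z == i) => //=.
all: by case: (G x' y == i); case: (G x' z == i) => //=; case: (G x y' == i);
  case: (G y' z == i) => //=; case: (G x z' == i); case: (G y z' == i).
Qed.

(** All pairs among x1, x2, x3 have G = i. The balance of x1 x2 y in the colour O
forces F = O there, and then its balance in the colour i leaves exactly one of
G x1 y, G x2 y equal to i. The same holds for the other two pairs, but an exact
choice of one from each pair of three is impossible. *)
Lemma no_two_dominant i j x1 x2 x3 y :
  all (mem B) [:: x1; x2; x3; y] -> uniq [:: x1; x2; x3] -> i != O -> j != O -> i != j ->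
  H x1 = i -> H x2 = i -> H x3 = i -> H y = j -> False.
Proof.
move=> /and5P[/= B1 B2 B3 By _] u123 iO jO ij H1 H2 H3 Hy.
have [n12 n13 n23] : [/\ x1 != x2, x1 != x3 & x2 != x3].
  by move: u123; rewrite /= !inE !negb_or => /and3P[/andP[]].
have Oi : (O == i) = false by rewrite eq_sym (negPf iO).
have ji : (j == i) = false by rewrite eq_sym (negPf ij).
have := balance i B1 B2 B3 u123; rewrite H1 H2 H3 Oi eqxx.
case G12: (G x1 x2 == i); case G13: (G x1 x3 == i); case G23: (G x2 x3 == i);
  rewrite ?addn0 ?addn1 //=; try by case: (F _ _ _ == i).
move=> _.
have odd1 p q : p \in B -> q \in B -> p != q -> H p = i -> H q = i -> G p q == i ->
    (G p y == i) + (G q y == i) = 1.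
  move=> Bp Bq pq Hp Hq Gpq.
  have py : p != y by apply: contra_neq ij => py; rewrite -Hp py.
  have qy : q != y by apply: contra_neq ij => qy; rewrite -Hq qy.
  have u : uniq [:: p; q; y] by rewrite /= !inE negb_or pq py qy.
  have := balance O Bp Bq By u; have := balance i Bp Bq By u.
  rewrite Hp Hq Hy Gpq Oi ji !eqxx (negPf iO) (negPf jO) !addn0.
  case: (F p q y =P O) => [->|_ _] //.
  by rewrite Oi => + _; case: (G p y == i); case: (G q y == i).
move: (odd1 _ _ B1 B2 n12 H1 H2 G12) (odd1 _ _ B1 B3 n13 H1 H3 G13).
move: (odd1 _ _ B2 B3 n23 H2 H3 G23).
by case: (_ == i); case: (_ == i); case: (_ == i).
Qed.

End Dominant.

(** * Unbalanced octahedra in rich configurations *)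

Definition balanced (V : finType) (C : eqType) (col : {set V} -> C) (o : 6.-tuple V) :=
  perm_eq (map col (positives o)) (map col (negatives o)).

(** With F the colour of a triple, the four triples of a claw are those that force
a vertex with H = i in [claw_vertex]. They are used rather than a single triple
because a positive density of one colour does not show in any bounded number of
disjoint triples: colouring a triple i when it contains a pair from a fixed perfect
matching is balanced, with many disjoint triples of a colour of negligible density. *)
Definition claw (V : finType) (C : eqType) (col : {set V} -> C) (i : C) (t : 6.-tuple V) :=
  if val t is [:: x; y; z; x'; y'; z'] then
    [&& col [set x; y; z] == i, col [set x'; y; z] == i,
        col [set x; y'; z] == i & col [set x; y; z'] == i]
  else false.

(** Labels of the sample points: three claws of six points for each of three
colours, and a reservoir in which a homogeneous triple is found. *)
Definition label N : finType := ((('I_3 * 'I_3) * 'I_6) + 'I_N)%type.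

Definition claw_at (V : finType) N (f : label N -> V) ck : 6.-tuple V :=
  [tuple f (inl (ck, l)) | l < 6].

Lemma set3C (V : finType) (x y z : V) : [set x; y; z] = [set y; x; z].
Proof. by apply/setP => v; rewrite !inE [(v == x) || _]orbC. Qed.

Lemma set3AC (V : finType) (x y z : V) : [set x; y; z] = [set x; z; y].
Proof. by apply/setP => v; rewrite !inE orbAC. Qed.

Lemma set3rot (V : finType) (x y z : V) : [set x; y; z] = [set y; z; x].
Proof. by rewrite set3C set3AC. Qed.

(** Three claws per colour supply the three vertices that [no_two_dominant] asks
of one colour, and it is not known beforehand which two colours differ from O. *)
Lemma unbalanced_exists (C : finType) : exists N, forall (V : finType)
    (col : {set V} -> C) (i : 'I_3 -> C) (f : label N -> V),
  injective i -> injective f -> (forall ck, claw col (i ck.1) (claw_at f ck)) ->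
  exists2 p : 6.-tuple (label N), uniq p & ~~ balanced col (map_tuple f p).
Proof.
pose I : finType := (('I_3 * 'I_3) * 'I_6)%type.
pose code : finType := ({ffun I * I -> C} * {ffun I * I -> C} * {ffun I -> C})%type.
have [N ramsey] := triangle_ramsey code; exists N => V col i f i_inj f_inj claws.
case: (boolP [exists p : 6.-tuple (label N), uniq p && ~~ balanced col (map_tuple f p)]).
  by move=> /existsP[p /andP[]]; exists p.
rewrite negb_exists => /forallP nob; exfalso.
pose P (p : I) : V := f (inl p); pose W a : V := f (inr a).
(* Both endpoints enter the edge colour, so that in a monochromatic triangle all
three points have the same triples with pairs of P. *)
pose e a b : code := ([ffun pq => col [set P pq.1; P pq.2; W a]],
  [ffun pq => col [set P pq.1; P pq.2; W b]], [ffun p => col [set P p; W a; W b]]).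
have [a [b [c [uabc e1 e2]]]] := ramsey e.
have ab p q : col [set P p; P q; W a] = col [set P p; P q; W b].
  by case: e2 => /ffunP/(_ (p, q)); rewrite !ffunE.
have bc p q : col [set P p; P q; W b] = col [set P p; P q; W c].
  by case: e2 => _ /ffunP/(_ (p, q)); rewrite !ffunE.
have hc p : col [set P p; W a; W b] = col [set P p; W a; W c].
  by case: e1 => _ /ffunP/(_ p); rewrite !ffunE.
have ha p : col [set P p; W a; W b] = col [set P p; W b; W c].
  by case: e2 => _ _ /ffunP/(_ p); rewrite !ffunE.
pose B : pred V := fun v => [exists p, P p == v].
pose F x y z := col [set x; y; z]; pose G x y := col [set x; y; W a].
pose H x := col [set x; W a; W b]; pose O := col [set W a; W b; W c].
have BP p : P p \in B by apply/existsP; exists p.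
have P_inj : injective P by move=> p q /f_inj [].
have Gsym x y : G x y = G y x by rewrite /G set3C.
have balance x y z j : x \in B -> y \in B -> z \in B -> uniq [:: x; y; z] ->
    (F x y z == j) + (H x == j) + (H y == j) + (H z == j) =
    (O == j) + (G x y == j) + (G x z == j) + (G y z == j).
  move=> /existsP[p /eqP<-] /existsP[q /eqP<-] /existsP[s /eqP<-] u.
  pose o : 6.-tuple (label N) := [tuple inl p; inr a; inl q; inr b; inl s; inr c].
  have uo : uniq o.
    move: u uabc; rewrite /= !inE !negb_or !(inj_eq P_inj).
    move=> /and3P[/andP[pq ps] qs _] /and3P[/andP[nab nac] nbc _].
    by rewrite !(inj_eq inl_inj) !(inj_eq inr_inj) pq ps qs nab nac nbc.
  have := nob o; rewrite uo /= negbK => /seq.permP/(_ (pred1 j)).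
  have -> : map_tuple f o = [tuple P p; W a; P q; W b; P s; W c] by apply: val_inj.
  have E1 : col [set P p; W b; W c] = H (P p) by rewrite -ha.
  have E2 : col [set W a; P q; W c] = H (P q) by rewrite set3C -hc.
  have E3 : col [set W a; W b; P s] = H (P s) by rewrite (set3rot (W a)) (set3rot (W b)).
  have E4 : col [set W a; P q; P s] = G (P q) (P s) by rewrite set3rot.
  have E5 : col [set P p; P q; W c] = G (P p) (P q) by rewrite -bc -ab.
  have E6 : col [set P p; W b; P s] = G (P p) (P s) by rewrite set3AC -ab.
  rewrite positivesE negativesE /= !addn0 E1 E2 E3 E4 E5 E6 -/(F _ _ _) -/O.
  by rewrite !addnA => ->; rewrite -!addnA addnCA; congr (_ + _); rewrite addnC -addnA.
have vertex ck : i ck.1 != O -> exists l, H (P (ck, l)) = i ck.1.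
  move=> iO; have := claws ck; rewrite /claw.
  have all_at x : x \in claw_at f ck -> exists l, x = P (ck, l).
    by move=> /mapP[l _ ->]; exists l.
  have ucl : uniq (claw_at f ck).
    by rewrite map_inj_uniq ?enum_uniq // => l l' /f_inj [].
  case E : (val _) => [|x [|y [|z [|x' [|y' [|z' [|? ?]]]]]]] //.
  have Bal : all (mem B) [:: x; y; z; x'; y'; z'].
    by rewrite -E; apply/allP => v /all_at[l ->]; apply: BP.
  move=> /and4P[/eqP c1 /eqP c2 /eqP c3 /eqP c4].
  have := claw_vertex Gsym balance Bal _ iO c1 c2 c3 c4.
  by rewrite -E => /(_ ucl) /hasP[v /all_at[l ->] /eqP]; exists l.
have [c1 [c2 [c12 i1 i2]]] : exists c1 c2 : 'I_3, [/\ c1 != c2, i c1 != O & i c2 != O].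
  have d01 : (ord0 : 'I_3) != inord 1 by rewrite -val_eqE /= inordK.
  have d02 : (ord0 : 'I_3) != inord 2 by rewrite -val_eqE /= inordK.
  have d12 : (inord 1 : 'I_3) != inord 2 by rewrite -val_eqE /= !inordK.
  have neO d d' : d != d' -> i d = O -> i d' != O.
    by move=> dd' <-; rewrite (inj_eq i_inj) eq_sym.
  case: (i ord0 =P O) => [e0|/eqP n0].
    by exists (inord 1), (inord 2); rewrite d12 !(neO ord0).
  case: (i (inord 1) =P O) => [e1'|/eqP n1].
    by exists ord0, (inord 2); rewrite d02 n0 (neO (inord 1)).
  by exists ord0, (inord 1).
have [l0 h0] := vertex (c1, inord 0) i1; have [l1 h1] := vertex (c1, inord 1) i1.
have [l2 h2] := vertex (c1, inord 2) i1; have [l h] := vertex (c2, inord 0) i2.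
apply: (no_two_dominant balance _ _ i1 i2 _ h0 h1 h2 h).
- by rewrite /= !BP.
- rewrite /= !inE !negb_or !(inj_eq P_inj) !xpair_eqE eqxx /=.
  by rewrite -!val_eqE /= !inordK.
- by rewrite (inj_eq i_inj).
Qed.

(** * Counting: unbalanced octahedra have positive density *)

Section Claws.
Variables (V : finType) (P : V -> V -> V -> bool).

Lemma poor_pairs m (Q : V -> V -> V -> bool) :
  m * \sum_x \sum_y \sum_z (Q x y z && (m * \sum_z' Q x y z' < #|V|)) <= #|V| ^ 3.
Proof.
rewrite (expnD _ 2 1) expnS expn1 -mulnA.
rewrite big_distrr -sum_nat_const /=; apply: leq_sum => x _.
rewrite big_distrr -sum_nat_const /=; apply: leq_sum => y _.
case: (ltnP (m * \sum_z' Q x y z') #|V|) => [lt|_].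
  by under eq_bigr do rewrite andbT; apply: ltnW.
by rewrite big1 ?muln0 // => z _; rewrite andbF.
Qed.

(** Discarding the triples in which some pair has fewer than |V| / 6d extensions
costs at most half of them, and each remaining triple can be extended to a claw in
(|V| / 6d)^3 ways. *)
Lemma many_extensions d :
  #|V| ^ 3 <= d * \sum_x \sum_y \sum_z P x y z ->
  #|V| ^ 6 <= 2 * d * (6 * d) ^ 3 * \sum_x \sum_y \sum_z
    P x y z * (\sum_x' P x' y z) * (\sum_y' P x y' z) * (\sum_z' P x y z').
Proof.
set n := #|V| => dens; set m := 6 * d.
pose cx y z := \sum_x' P x' y z; pose cy x z := \sum_y' P x y' z.
pose cz x y := \sum_z' P x y z'.
pose g x y z := [&& P x y z, n <= m * cx y z, n <= m * cy x z & n <= m * cz x y].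
have split3 : \sum_x \sum_y \sum_z P x y z <=
    \sum_x \sum_y \sum_z g x y z + \sum_x \sum_y \sum_z (P x y z && (m * cz x y < n))
    + \sum_x \sum_y \sum_z (P x y z && (m * cy x z < n))
    + \sum_x \sum_y \sum_z (P x y z && (m * cx y z < n)).
  rewrite -!big_split; apply: leq_sum => x _; rewrite -!big_split; apply: leq_sum => y _.
  rewrite -!big_split; apply: leq_sum => z _ /=; rewrite /g.
  case: (P x y z) => //=.
  by case: (leqP n (m * cx y z)); case: (leqP n (m * cy x z)); case: (leqP n (m * cz x y)).
have low1 := poor_pairs m P.
have low2 := poor_pairs m (fun x z y => P x y z).
have low3 := poor_pairs m (fun y z x => P x y z).
have rich : n ^ 3 <= 2 * d * \sum_x \sum_y \sum_z g x y z.
  have e2 : \sum_x \sum_y \sum_z (P x y z && (m * cy x z < n)) =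
      \sum_x \sum_y \sum_z (P x z y && (m * \sum_z' P x z' y < n)).
    by apply: eq_bigr => x _; rewrite exchange_big.
  have e3 : \sum_x \sum_y \sum_z (P x y z && (m * cx y z < n)) =
      \sum_x \sum_y \sum_z (P z x y && (m * \sum_z' P z' x y < n)).
    rewrite exchange_big; apply: eq_bigr => y _.
    by rewrite exchange_big; apply: eq_bigr => z _.
  move: split3 low1 low2 low3 dens; rewrite e2 e3 /m -/n.
  move: (\sum_x \sum_y \sum_z P x y z) (\sum_x \sum_y \sum_z g x y z) => a b.
  move: (\sum_x \sum_y _) (\sum_x \sum_y _) (\sum_x \sum_y _) (n ^ 3) => u v w N3.
  by nia.
rewrite (expnD _ 3 3); apply: leq_trans (leq_mul rich (leqnn _)) _.
rewrite -/m -(mulnA (2 * d) (m ^ 3)) -(mulnA (2 * d)) leq_mul //.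
rewrite big_distrl big_distrr /=; apply: leq_sum => x _.
rewrite big_distrl big_distrr /=; apply: leq_sum => y _.
rewrite big_distrl big_distrr /=; apply: leq_sum => z _.
rewrite /g; case: (P x y z) => //=; rewrite mul1n -/(cx y z) -/(cy x z) -/(cz x y).
case: (leqP n (m * cx y z)) => h1 //=; case: (leqP n (m * cy x z)) => h2 //=.
case: (leqP n (m * cz x y)) => h3 //=.
rewrite mul1n [n ^ 3](_ : _ = n * n * n); last by ring.
rewrite [leqRHS](_ : _ = (m * cx y z) * (m * cy x z) * (m * cz x y)); last by ring.
by rewrite !leq_mul.
Qed.

End Claws.

Lemma prod3_sum (V : finType) (p : bool) (a b c : V -> bool) :
  p * (\sum_x a x) * (\sum_x b x) * (\sum_x c x) =
  \sum_x \sum_y \sum_z [&& p, a x, b y & c z].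
Proof.
rewrite [p * _]big_distrr !big_distrl /=; apply: eq_bigr => x _.
rewrite [p * a x * _]big_distrr !big_distrl /=; apply: eq_bigr => y _.
rewrite [p * a x * b y * _]big_distrr /=; apply: eq_bigr => z _.
by rewrite !mulnb !andbA.
Qed.

Lemma many_claws (V : finType) (C : eqType) (col : {set V} -> C) i d :
  #|V| ^ 3 <= d * #|[set t : 3.-tuple V | uniq t & col [set x in t] == i]| ->
  #|V| ^ 6 <= 2 * d * (6 * d) ^ 3 * #|[set t | claw col i t]|.
Proof.
pose P x y z := col [set x; y; z] == i.
move=> dens; apply: leq_trans (many_extensions (P := P) (d := d) _) _.
  apply: leq_trans dens _; rewrite leq_mul2l; apply/orP; right.
  rewrite pair_bigA pair_bigA /=.
  pose h (t : 3.-tuple V) := (tnth t ord0, tnth t (inord 1), tnth t (inord 2)).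
  have tE (t : 3.-tuple V) : val t = [:: (h t).1.1; (h t).1.2; (h t).2].
    case: t => [[|x [|y [|z [|? ?]]]]] //= sz.
    by rewrite /h !(tnth_nth x) /= !inordK.
  have h_inj : injective h by move=> t t' e; apply: val_inj; rewrite /= !tE e.
  rewrite -(card_imset _ h_inj) -sum1_card big_mkcond /=; apply: leq_sum => p _.
  case: imsetP => // -[t]; rewrite inE => /andP[_ ct] ->.
  suff -> : P (h t).1.1 (h t).1.2 (h t).2 by [].
  rewrite /P -(eqP ct); apply/eqP; congr col; apply/setP => v.
  by rewrite !inE -[v \in t]/(v \in val t) tE !inE orbA.
apply: leq_mul => //.
under eq_bigr do (under eq_bigr do (under eq_bigr do rewrite prod3_sum)).
rewrite pair_bigA pair_bigA /= pair_bigA /= pair_bigA /= pair_bigA /=.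
pose h (p : V * V * V * V * V * V) : 6.-tuple V :=
  [tuple p.1.1.1.1.1; p.1.1.1.1.2; p.1.1.1.2; p.1.1.2; p.1.2; p.2].
have h_inj : injective h.
  by move=> [[[[[x y] z] x'] y'] z'] [[[[[? ?] ?] ?] ?] ?] [-> -> -> -> -> ->].
apply: (@leq_trans #|[set p | claw col i (h p)]|).
  rewrite -sum1_card [leqRHS]big_mkcond /=; apply: leq_sum => p _.
  by rewrite inE /claw /= /P; case: ifP.
rewrite -(card_imset _ h_inj); apply/subset_leq_card/subsetP => t.
by case/imsetP => p; rewrite !inE => cp ->.
Qed.

Section Sampling.
Variables J V : finType.

(** Fixing the values of a map at k distinct points leaves |J| - k free. *)
Lemma card_pullback k (p : k.-tuple J) (B : {set k.-tuple V}) : uniq p ->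
  #|[set f : {ffun J -> V} | map_tuple f p \in B]| * #|V| ^ k <= #|B| * #|V| ^ #|J|.
Proof.
move=> up; pose R : finType := {j : J | j \notin p}.
have cR : #|R| + k = #|J|.
  have cp : #|p| = k by rewrite (card_uniqP up) size_tuple.
  by rewrite card_sig addnC -(cardC (mem p)) cp.
pose h (f : {ffun J -> V}) := (map_tuple f p, [ffun j : R => f (val j)]).
have h_inj : injective h.
  move=> f f' [/= e1 /ffunP e2]; apply/ffunP => j.
  case: (boolP (j \in p)) => [jp|jp].
    by move: j jp; apply/eq_in_map.
  by have := e2 (exist _ j jp); rewrite !ffunE.
rewrite -cR expnD mulnA leq_mul2r -(card_imset _ h_inj); apply/orP; right.
rewrite -card_ffun -[#|{ffun R -> V}|]cardsT -cardsX; apply/subset_leq_card/subsetP => u.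
by case/imsetP => f; rewrite inE => fB ->; rewrite !inE fB.
Qed.

(** Union bound over the positions p. *)
Lemma card_hits k (B : {set k.-tuple V}) :
  #|[set f : {ffun J -> V} | [exists p : k.-tuple J, uniq p && (map_tuple f p \in B)]]|
    * #|V| ^ k <= #|J| ^ k * (#|B| * #|V| ^ #|J|).
Proof.
apply: (@leq_trans (\sum_(p : k.-tuple J | uniq p)
    #|[set f : {ffun J -> V} | map_tuple f p \in B]| * #|V| ^ k)).
  rewrite -big_distrl /= leq_mul2r; apply/orP; right.
  under [leqRHS]eq_bigr do rewrite -sum1_card big_mkcond /=.
  rewrite [leqRHS]exchange_big -[leqLHS]sum1_card [leqLHS]big_mkcond /=; apply: leq_sum => f _; rewrite inE.
  case: existsP => // -[p /andP[up fp]].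
  by rewrite (bigD1 p) //= inE fp.
rewrite -(card_tuple k J) -[leqRHS]sum_nat_const [leqRHS](bigID (fun p : k.-tuple J => uniq p)) /=.
apply: leq_trans (leq_addr _ _); apply: leq_sum => p up; exact: card_pullback.
Qed.

Lemma card_noninjective :
  #|[set f : {ffun J -> V} | ~~ injectiveb f]| * #|V| <= #|J| ^ 2 * #|V| ^ #|J|.
Proof.
have [V0|V0] := posnP #|V|; first by rewrite V0 muln0.
pose D := [set t : 2.-tuple V | tnth t ord0 == tnth t (inord 1)].
have cD : #|D| <= #|V|.
  have inj : {in D &, injective (fun t : 2.-tuple V => tnth t ord0)}.
    move=> [[|a [|b [|? ?]]] //= s1] [[|c [|d [|? ?]]] //= s2].
    rewrite !inE !(tnth_nth a) /= !inordK //= => /eqP -> /eqP ->.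
    by move=> e; apply: val_inj; rewrite /= e.
  by rewrite -(card_in_imset inj) max_card.
rewrite -(leq_pmul2r V0); apply: leq_trans (_ : _ <= #|J| ^ 2 * (#|D| * #|V| ^ #|J|)) _.
  apply: leq_trans (card_hits D); rewrite -mulnA mulnn leq_mul2r; apply/orP; right.
  apply/subset_leq_card/subsetP => f; rewrite !inE => /injectivePn[x [y xy fxy]].
  apply/existsP; exists [tuple x; y]; rewrite /= !inE xy /=.
  by rewrite !(tnth_nth (f x)) /= inordK //= fxy.
by rewrite -mulnA leq_mul2l mulnC leq_mul2l cD !orbT.
Qed.

End Sampling.

(** The nine claws and the reservoir use disjoint sets of labels, so the numbers of
choices multiply. *)
Lemma claw_maps (V : finType) N (Z : 'I_3 -> {set 6.-tuple V}) K :
  (forall c, #|V| ^ 6 <= K * #|Z c|) ->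
  #|V| ^ #|label N| <=
  K ^ 9 * #|[set f : {ffun label N -> V} | [forall ck, claw_at f ck \in Z ck.1]]|.
Proof.
move=> hZ; set E := [set f | _].
pose fam := family (fun ck : 'I_3 * 'I_3 => mem (Z ck.1)).
pose h (u : {ffun 'I_3 * 'I_3 -> 6.-tuple V} * {ffun 'I_N -> V}) : {ffun label N -> V} :=
  [ffun j => match j with inl (ck, l) => tnth (u.1 ck) l | inr a => u.2 a end].
have hck u ck : claw_at (h u) ck = u.1 ck.
  by apply: eq_from_tnth => l; rewrite tnth_mktuple ffunE.
have h_inj : injective h.
  move=> u v e; rewrite [u]surjective_pairing [v]surjective_pairing; congr (_, _).
    by apply/ffunP => ck; rewrite -!hck e.
  by apply/ffunP => a; move/ffunP/(_ (inr a)): e; rewrite !ffunE.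
have low : #|fam| * #|V| ^ N <= #|E|.
  have <- : #|{ffun 'I_N -> V}| = #|V| ^ N by rewrite card_ffun card_ord.
  rewrite -cardX -(card_imset _ h_inj); apply/subset_leq_card/subsetP => f.
  case/imsetP => -[u v] /andP[/= /familyP fu _] ->.
  by rewrite inE; apply/forallP => ck; rewrite hck; apply: fu.
have prod : (#|V| ^ 6) ^ 9 <= K ^ 9 * #|fam|.
  rewrite card_family foldrE big_map big_enum /=.
  have c9 : #|{: 'I_3 * 'I_3}| = 9 by rewrite card_prod card_ord.
  rewrite -[in leqLHS]c9 -[in leqRHS]c9 -!prod_nat_const -big_split /=.
  by apply: leq_prod => ck _.
have -> : #|label N| = 6 * 9 + N by rewrite card_sum !card_prod !card_ord.
rewrite expnD expnM; apply: leq_trans (leq_mul prod (leqnn _)) _.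
by rewrite -mulnA leq_mul2l low orbT.
Qed.

(** A map of the labels which has all its claws is not injective or contains an
unbalanced octahedron. The former kind is negligible, so the latter is a positive
proportion of all maps, and [card_hits] bounds it by the density of unbalanced
octahedra. *)
Lemma many_unbalanced (C : finType) d : exists D N, forall (V : finType)
    (col : {set V} -> C) (i : 'I_3 -> C), N <= #|V| -> injective i ->
  (forall c, #|V| ^ 3 <= d * #|[set t : 3.-tuple V | uniq t & col [set x in t] == i c]|) ->
  #|V| ^ 6 <= D * #|[set o : 6.-tuple V | uniq o & ~~ balanced col o]|.
Proof.
have [N unb] := unbalanced_exists C.
pose K := (2 * d * (6 * d) ^ 3) ^ 9; pose m := #|label N|.
exists (2 * K * m ^ 6), (2 * K * m ^ 2).+1 => V col i large i_inj dens.
set Bad := [set o | _]; set n := #|V|.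
have n0 : 0 < n by apply: leq_trans large.
have := claw_maps N (fun c => many_claws (dens c)); rewrite -/K -/m -/n => E2.
have := card_noninjective (label N) V; rewrite -/m -/n => E1.
have := card_hits (label N) Bad; rewrite -/m -/n => E3.
have cover : #|[set f : {ffun label N -> V} |
      [forall ck, claw_at f ck \in [set t | claw col (i ck.1) t]]]| <=
    #|[set f : {ffun label N -> V} | ~~ injectiveb f]| +
    #|[set f : {ffun label N -> V} |
      [exists p : 6.-tuple (label N), uniq p && (map_tuple f p \in Bad)]]|.
  apply: leq_trans (leq_card_setU _ _); apply/subset_leq_card/subsetP => f.
  rewrite !inE => /forallP cl; case: (boolP (injectiveb f)) => //= /injectiveP f_inj.
  have [|p up bp] := unb V col i f i_inj f_inj; first by move=> ck; have := cl ck; rewrite inE.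
  by apply/existsP; exists p; rewrite up inE bp andbT /= map_inj_uniq.
move: E1 E2 E3 cover large.
move: #|[set f | ~~ injectiveb _]| #|[set f | [exists p, _]]| #|[set f | [forall ck, _]]|.
move=> a b e E1 E2 E3 cover large.
have vm0 : 0 < n ^ m by rewrite expn_gt0 n0.
rewrite -(leq_pmul2l vm0); move: (n ^ m) #|Bad| (m ^ 6) (m ^ 2) E1 E2 E3 large => v B m6 m2.
rewrite (expnS n 5); move: (n ^ 5) => w E1 E2 E3 large.
have h1 : 2 * (v * (n * w)) <= 2 * (K * (a + b) * (n * w)).
  by rewrite !leq_mul // (leq_trans E2) // leq_mul.
have h2 : 2 * (K * a * (n * w)) <= v * (n * w).
  have -> : 2 * (K * a * (n * w)) = 2 * K * w * (a * n) by ring.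
  apply: leq_trans (leq_mul (leqnn _) E1) _.
  have -> : 2 * K * w * (m2 * v) = (2 * K * m2) * (v * w) by ring.
  have -> : v * (n * w) = n * (v * w) by ring.
  by rewrite leq_mul // ltnW.
have h3 : 2 * (K * b * (n * w)) <= v * (2 * K * m6 * B).
  have -> : 2 * (K * b * (n * w)) = 2 * K * (b * (n * w)) by ring.
  have -> : v * (2 * K * m6 * B) = 2 * K * (m6 * (B * v)) by ring.
  by rewrite leq_mul.
rewrite mulnDr mulnDl mulnDr in h1; have := leq_trans h1 (leq_add h2 h3).
by rewrite mul2n -addnn leq_add2l.
Qed.

(** * Steiner triple systems with many disjoint Pasch configurations *)

(** An idempotent commutative quasigroup f with its left division g; when g is
f, the sets {x, y, f x y} form a Steiner triple system. *)
Definition icq (P : Type) (f g : P -> P -> P) :=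
  [/\ forall x, f x x = x, commutative f, forall x y, f x (g x y) = y
    & forall x y, g x (f x y) = y].

Notation squag m := (icq m m).

Section Icq.
Variables (P : Type) (f g : P -> P -> P).
Hypothesis fg : icq f g.

Lemma icq_divxx x : g x x = x.
Proof. by case: fg => f1 _ _ gK; rewrite -{2}(f1 x) gK. Qed.

Lemma icq_mul_eq x y : f x y = x -> y = x.
Proof. by case: fg => f1 _ _ gK e; rewrite -(gK x y) e icq_divxx. Qed.

Lemma icq_div_eq x y : g x y = x -> y = x.
Proof. by case: fg => f1 _ fK _ e; rewrite -(fK x y) e f1. Qed.

End Icq.

Section Blocks.
Variables (P : finType) (m : P -> P -> P).
Hypothesis sq : squag m.

Definition blocks : {set {set P}} :=
  [set [set xy.1; xy.2; m xy.1 xy.2] | xy : P * P & xy.1 != xy.2].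

Lemma block_in x y : x != y -> [set x; y; m x y] \in blocks.
Proof. by move=> xy; apply/imsetP; exists (x, y); rewrite ?inE. Qed.

Lemma squag_ne x y : x != y -> (m x y != x) && (m x y != y).
Proof.
move=> xy; apply/andP; split; apply: contra_neq xy.
  by move/(icq_mul_eq sq) => ->.
by case: (sq) => _ mC _ _; rewrite mC => /(icq_mul_eq sq).
Qed.

Lemma blocksP T : T \in blocks ->
  exists x y, [/\ x != y, T = [set x; y; m x y] & #|T| = 3].
Proof.
case/imsetP => -[x y]; rewrite inE /= => xy ->; exists x, y; split=> //.
have /andP[nx ny] := squag_ne xy.
by rewrite -setUA !cardsU1 cards1 !inE negb_or xy ![_ == m x y]eq_sym nx ny.
Qed.

Lemma blocks_sts : sts blocks.
Proof.
split=> [T /blocksP[x [y []]] //|p q pq].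
have key T : T \in blocks -> p \in T -> q \in T -> T = [set p; q; m p q].
  case/imsetP => -[x y]; rewrite inE /= => xy ->.
  have [_ mC mK _] := sq.
  have e1 : m x (m x y) = y by [].
  have e2 : m y (m x y) = x by rewrite (mC x).
  rewrite !inE => /orP[/orP[]|] /eqP ep /orP[/orP[]|] /eqP eq; move: pq;
    rewrite ep eq ?eqxx // => _; rewrite ?(mC y x) ?(mC (m x y)) ?e1 ?e2 //;
    apply/setP => v; rewrite !inE; case: (v == x); case: (v == y); case: (v == m x y) => //.
rewrite (bigD1 [set p; q; m p q]) ?block_in //= !inE !eqxx orbT /= big1 // => T.
by case/andP => Tb; case: andP => // -[pT qT]; rewrite (key T) ?eqxx.
Qed.

End Blocks.

Definition switchable (V : finType) (S : {set {set V}}) (L : seq (6.-tuple V)) :=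
  [/\ sts S, uniq L, forall o, o \in L -> uniq o /\ {subset positives o <= S}
    & forall o o' T, o \in L -> o' \in L ->
        T \in positives o -> T \in positives o' -> o = o'].

(** For each pair (u, w), the points A u e and B w e are the first four vertices of
an octahedron whose positive faces are triples of m. The values of pr on a triple
reveal u and w, hence different pairs have no triple in common. *)
Definition pasch_grid (P : finType) h := exists (m : P -> P -> P)
    (A B : 'I_h -> bool -> P) (Z : 'I_h -> 'I_h -> bool -> P) (pr : P -> nat),
  [/\ squag m, forall u w e e', m (A u e) (B w e') = Z u w (e (+) e'),
      forall u, A u false != A u true, forall w, B w false != B w true &
      forall u w e, [/\ pr (A u e) = u, pr (B w e) = h + w & pr (Z u w e) = 2 * h]].

Lemma transport_grid (P Q : finType) h (f : P -> Q) (g : Q -> P) :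
  cancel f g -> cancel g f -> pasch_grid P h -> pasch_grid Q h.
Proof.
move=> fK gK [m [A [B [Z [pr [[m1 mC mK _] mAB nA nB prE]]]]]].
have f_inj := can_inj fK.
exists (fun x y => f (m (g x) (g y))), (fun u e => f (A u e)), (fun w e => f (B w e)).
exists (fun u w e => f (Z u w e)), (pr \o g); split.
- split=> [x|x y|x y|x y]; first by rewrite m1 gK.
  + by rewrite mC.
  + by rewrite fK mK gK.
  + by rewrite fK mK gK.
- by move=> u w e e'; rewrite !fK mAB.
- by move=> u; rewrite (inj_eq f_inj).
- by move=> w; rewrite (inj_eq f_inj).
- by move=> u w e; rewrite /= !fK.
Qed.

Lemma grid_switchable (P : finType) h : pasch_grid P h ->
  exists (S : {set {set P}}) (L : seq (6.-tuple P)), switchable S L /\ size L = h ^ 2.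
Proof.
move=> [m [A [B [Z [pr [sq mAB nA nB prE]]]]]].
pose o (uw : 'I_h * 'I_h) : 6.-tuple P := [tuple A uw.1 false; A uw.1 true;
  B uw.2 false; B uw.2 true; Z uw.1 uw.2 false; Z uw.1 uw.2 true].
have prA u e : pr (A u e) = u by case: (prE u u e).
have prB w e : pr (B w e) = h + w by case: (prE w w e).
have prZ u w e : pr (Z u w e) = 2 * h by case: (prE u w e).
have prs uw T : T \in positives (o uw) ->
    (forall v, v \in T -> pr v \in [:: val uw.1; h + uw.2; 2 * h]) /\
    (exists2 v, v \in T & pr v = uw.1) /\ (exists2 v, v \in T & pr v = h + uw.2).
  rewrite positivesE !inE => /or4P[] /eqP ->; split.
  all: try by move=> v; rewrite !inE => /orP[/orP[]|] /eqP ->;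
    rewrite ?prA ?prB ?prZ eqxx ?orbT.
  - by split; [exists (A uw.1 false)|exists (B uw.2 false)]; rewrite // !inE eqxx ?orbT.
  - by split; [exists (A uw.1 false)|exists (B uw.2 true)]; rewrite // !inE eqxx ?orbT.
  - by split; [exists (A uw.1 true)|exists (B uw.2 false)]; rewrite // !inE eqxx ?orbT.
  - by split; [exists (A uw.1 true)|exists (B uw.2 true)]; rewrite // !inE eqxx ?orbT.
have dis uw uw' T : T \in positives (o uw) -> T \in positives (o uw') -> uw = uw'.
  move=> /prs[_ [[v vT pv] [v' vT' pv']]] /prs[all' _].
  move: (all' _ vT) (all' _ vT'); rewrite pv pv' !inE.
  case: uw uw' {pv pv' all'} => [u w] [u' w'] /=.
  have := ltn_ord u; have := ltn_ord w; have := ltn_ord u'; have := ltn_ord w'.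
  by move=> *; congr (_, _); apply: val_inj => /=; lia.
have neAB u e w e' : A u e != B w e'.
  by apply/eqP => /(congr1 pr); rewrite prA prB; have := ltn_ord u; lia.
have neAZ u e u' w e' : A u e != Z u' w e'.
  by apply/eqP => /(congr1 pr); rewrite prA prZ; have := ltn_ord u; lia.
have neBZ w e u w' e' : B w e != Z u w' e'.
  by apply/eqP => /(congr1 pr); rewrite prB prZ; have := ltn_ord w; lia.
have neZ u w : Z u w false != Z u w true.
  have [_ _ mK _] := sq.
  apply: contra_neq (nB w) => e; rewrite -(mK (A u false) (B w false)).
  by rewrite mAB /= e -(mAB u w false true) mK.
have uo uw : uniq (o uw).
  by rewrite /= !inE !negb_or nA nB neZ !neAB !neAZ !neBZ.
have o_inj : injective o.
  by move=> uw uw' e; apply: (dis _ _ [set A uw.1 false; B uw.2 false; Z uw.1 uw.2 false]);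
    rewrite -?e positivesE inE eqxx.
exists (blocks m), (map o (enum {: 'I_h * 'I_h})).
rewrite size_map -cardE card_prod card_ord; split=> //; split.
- exact: blocks_sts.
- by rewrite map_inj_uniq ?enum_uniq.
- move=> _ /mapP[uw _ ->]; split=> // T; rewrite positivesE !inE.
  have blk e e' : [set A uw.1 e; B uw.2 e'; Z uw.1 uw.2 (e (+) e')] \in blocks m.
    by rewrite -mAB block_in.
  by case/or4P => /eqP ->; [apply: (blk false false)|apply: (blk false true)
    |apply: (blk true false)|apply: (blk true true)].
- by move=> _ _ T /mapP[uw _ ->] /mapP[uw' _ ->] h1 h2; rewrite (dis _ _ _ h1 h2).
Qed.

(** * Doubling, Bose and Skolem constructions *)

(** The doubling v -> 2v + 1: two copies of each point, plus one point completing
each pair of copies. Each triple of a Steiner triple system becomes a Pasch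
configuration. The formula preserves idempotent commutative quasigroups and acts on
the division in the same way. *)
Definition dbl (P : eqType) (f : P -> P -> P) (p q : option (P * bool)) :=
  match p, q with
  | None, None => None
  | None, Some (x, e) | Some (x, e), None => Some (x, ~~ e)
  | Some (x, e), Some (y, e') =>
      if x == y then (if e == e' then Some (x, e) else None) else Some (f x y, e (+) e')
  end.

Lemma dbl_cancel (P : eqType) (f g : P -> P -> P) p q :
  (forall x, f x x = x) -> (forall x y, f x (g x y) = y) ->
  dbl f p (dbl g p q) = q.
Proof.
move=> f1 fK; case: p q => [[x e]|] [[y e']|] //=; rewrite ?eqxx ?negbK //; last first.
  by case: e.
have [<-|xy] := eqVneq x y.
  by case: eqP => [->|ee']; rewrite /= ?eqxx //; case: e e' ee' => [] [].
rewrite /=; have [xg|_] := eqVneq x (g x y); last by rewrite fK addbA addbb.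
by move: (fK x y); rewrite -xg f1 => e2; rewrite e2 eqxx in xy.
Qed.

Lemma dbl_icq (P : eqType) (f g : P -> P -> P) : icq f g -> icq (dbl f) (dbl g).
Proof.
move=> fg; have [f1 fC fK gK] := fg; split.
- by case=> [[x e]|] //=; rewrite !eqxx.
- case=> [[x e]|] [[y e']|] //=; rewrite [y == x]eq_sym fC addbC.
  by have [->|//] := eqVneq x y; rewrite eq_sym; case: eqP => [->|].
- by move=> p q; apply: dbl_cancel.
- by move=> p q; apply: dbl_cancel => // x; apply: icq_divxx fg x.
Qed.

Lemma dbl_grid (P : finType) (m : P -> P -> P) h (a b : 'I_h -> P) (pr : P -> nat) :
  squag m -> (forall u w, [/\ pr (a u) = u, pr (b w) = h + w & pr (m (a u) (b w)) = 2 * h]) ->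
  pasch_grid (option (P * bool))%type h.
Proof.
move=> sq prE; exists (dbl m), (fun u e => Some (a u, e)), (fun w e => Some (b w, e)).
exists (fun u w e => Some (m (a u) (b w), e)).
exists (fun p => if p is Some (x, _) then pr x else 0); split.
- exact: dbl_icq.
- move=> u w e e' /=; have [ab|//] := eqVneq (a u) (b w).
  have [pa pb _] := prE u w; have := ltn_ord u; move: pb; rewrite -ab pa; lia.
- by move=> u; apply/eqP => -[].
- by move=> w; apply/eqP => -[].
- by move=> u w e; apply: prE.
Qed.

(** Three elements in the cyclic order None, Some false, Some true; case analysis
then computes. *)
Notation level := (option bool).
Definition up (i : level) : level :=
  match i with None => Some false | Some false => Some true | Some true => None end.

(** The Bose construction: levels are arranged cyclically, and two points of one
level are completed by a point of the next. *)
Definition bose (Q : eqType) (f g : Q -> Q -> Q) (p q : Q * level) : Q * level :=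
  let: ((x, i), (y, j)) := (p, q) in
  if i == j then (if x == y then (x, i) else (f x y, up i))
  else if j == up i then (if x == y then (x, up j) else (g x y, i))
  else (if x == y then (x, up i) else (g y x, j)).

Lemma bose_squag (Q : eqType) (f g : Q -> Q -> Q) : icq f g -> squag (bose f g).
Proof.
move=> fg; have [f1 fC fK gK] := fg.
have fxy x y : x != y -> (x == f x y) = false.
  by move=> xy; apply/eqP => /esym/(icq_mul_eq fg) e; rewrite e eqxx in xy.
have gxy x y : x != y -> (x == g x y) = false.
  by move=> xy; apply/eqP => /esym/(icq_div_eq fg) e; rewrite e eqxx in xy.
have gyx x y : x != y -> (x == g y x) = false.
  move=> xy; apply/eqP => e; move: (fK y x); rewrite -e fC => /(icq_mul_eq fg) e'.
  by rewrite e' eqxx in xy.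
have gg x y : g (g y x) x = y by rewrite -{2}(fK y x) fC gK.
have bK x i y j : bose f g (x, i) (bose f g (x, i) (y, j)) = (y, j).
  have [<-|xy] := eqVneq x y.
    by case: i j => [[]|] [[]|]; rewrite /bose /= ?eqxx //= ?eqxx.
  by case: i j => [[]|] [[]|]; rewrite /bose /= ?(negPf xy) //=
    ?(fxy _ _ xy) ?(gxy _ _ xy) ?(gyx _ _ xy) //= ?fK ?gK ?gg.
split=> [[x i]|[x i] [y j]|[x i] [y j]|[x i] [y j]].
- by rewrite /bose !eqxx.
- rewrite /bose [y == x]eq_sym fC.
  by have [->|_] := eqVneq x y; case: i j => [[]|] [[]|].
- exact: bK.
- exact: bK.
Qed.

(** The Skolem construction. The map t is a fixed-point-free involution, f x x
is x on one half of Q and t x on the other; the pairs of consecutive levels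
missed by the triples {(x, i), (y, i), (f x y, i + 1)} are collected into the
vertical triples over the first half and the triples through the extra point. *)
Definition skolem (Q : eqType) (f g : Q -> Q -> Q) (t : Q -> Q)
    (p q : option (Q * level)) : option (Q * level) :=
  let slant x y i :=
    if f x x == y then (if x == y then Some (x, up (up i)) else None)
    else Some (g x y, i) in
  match p, q with
  | None, None => None
  | None, Some (x, i) | Some (x, i), None =>
      if f x x == x then Some (t x, up (up i)) else Some (t x, up i)
  | Some (x, i), Some (y, j) =>
      if i == j then (if x == y then Some (x, i) else Some (f x y, up i))
      else if j == up i then slant x y i else slant y x j
  end.

Lemma skolem_squag (Q : eqType) (f g : Q -> Q -> Q) (t : Q -> Q) :
  commutative f -> (forall x y, f x (g x y) = y) -> (forall x y, g x (f x y) = y) ->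
  involutive t -> (forall x, f x x = if f x x == x then x else t x) ->
  (forall x, (f (t x) (t x) == t x) = ~~ (f x x == x)) ->
  squag (skolem f g t).
Proof.
move=> fC fK gK tK fxx ft.
have txN x : (t x == x) = false.
  by apply/eqP => e; have := ft x; rewrite e; case: (_ == x).
have f_inj x y z : (f x y == f x z) = (y == z).
  by apply/eqP/eqP => [e|-> //]; rewrite -(gK x y) e gK.
have gx x y : (x == g x y) = (f x x == y) by rewrite -(f_inj x) fK.
have gg x y : g (g y x) x = y by rewrite -{2}(fK y x) fC gK.
pose slant x y i := if f x x == y then (if x == y then Some (x, up (up i)) else None)
  else Some (g x y, i).
pose sk := skolem f g t.
have up3 i : up (up (up i)) = i by case: i => [[]|].
have sk0 x y i : sk (Some (x, i)) (Some (y, i)) =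
    if x == y then Some (x, i) else Some (f x y, up i) by rewrite /sk /= eqxx.
have sk1 x y i : sk (Some (x, i)) (Some (y, up i)) = slant x y i.
  by case: i => [[]|].
have sk2 x y i : sk (Some (x, up i)) (Some (y, i)) = slant y x i.
  by case: i => [[]|].
have skN x i : sk (Some (x, i)) None =
  if f x x == x then Some (t x, up (up i)) else Some (t x, up i) by [].
have skC : commutative sk.
  move=> [[x i]|] [[y j]|] //=; rewrite /sk /= [y == x]eq_sym fC.
  by have [->|_] := eqVneq x y; case: i j => [[]|] [[]|].
have KN x i : sk (Some (x, i)) (sk (Some (x, i)) None) = None.
  rewrite skN; case: ifP => fx.
    rewrite -{1}(up3 i) sk2 /slant txN fxx ft fx tK eqxx.
    by [].
  by rewrite sk1 /slant fxx fx eqxx eq_sym txN.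
have NK x i : sk None (sk None (Some (x, i))) = Some (x, i).
  rewrite [sk None (Some _)]skC skN; case: ifP => fx; rewrite skC skN ft fx tK ?up3 //.
have K0 x y i : sk (Some (x, i)) (sk (Some (x, i)) (Some (y, i))) = Some (y, i).
  rewrite sk0; have [<-|xy] := eqVneq x y; first by rewrite sk0 eqxx.
  by rewrite sk1 /slant f_inj (negPf xy) gK.
have K1 x y i : sk (Some (x, i)) (sk (Some (x, i)) (Some (y, up i))) = Some (y, up i).
  rewrite sk1 /slant; case: ifP => [/eqP fy|fy].
    have [xy|xy] := eqVneq x y.
      by rewrite -{1}(up3 i) sk2 /slant fy -xy eqxx up3.
    by rewrite skN fy eq_sym (negPf xy) -fy [in RHS]fxx fy eq_sym (negPf xy).
  by rewrite sk0 gx fy fK.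
have K2 x y i : sk (Some (x, up i)) (sk (Some (x, up i)) (Some (y, i))) = Some (y, i).
  rewrite sk2 /slant; case: ifP => [/eqP fy|fy].
    have [xy|xy] := eqVneq y x.
      by move: fy; rewrite xy => fx; rewrite sk1 /slant fx !eqxx up3.
    have fyt : f y y == y = false by rewrite fy eq_sym (negPf xy).
    have xt : x = t y by rewrite -fy fxx fyt.
    by rewrite skN xt ft fyt tK up3.
  have fw : f (g y x) y = x by rewrite fC fK.
  have fww : (f (g y x) (g y x) == x) = false.
    by rewrite -[X in _ == X]fw f_inj eq_sym gx.
  by rewrite sk2 /slant fww gg.
have K x i q : sk (Some (x, i)) (sk (Some (x, i)) q) = q.
  case: q => [[y j]|] //.
  have [->|ij] := eqVneq i j; first exact: K0.
  have [->|ji] := eqVneq j (up i); first exact: K1.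
  have -> : i = up j by case: i j ij ji => [[]|] [[]|].
  exact: K2.
split=> [[[x i]|] //|//| |].
- by rewrite -/sk sk0 eqxx.
- by case=> [[x i]|] q //; case: q => [[x i]|].
- by case=> [[x i]|] q //; case: q => [[x i]|].
Qed.

(** * Orders 1 and 3 modulo 6 *)

Section Skolem.
Variable k : nat.
Let t := k.+1.
Let Q := 'I_(k.*2.+2).
Let ltQ (x : Q) : x < 2 * t.
Proof. by have := ltn_ord x; rewrite /t; lia. Qed.

(* Relabels the sums so that sig (x + x) is x modulo t: the even residues go in
order to the first half, the odd ones to the second. *)
Let sig (x : Q) : Q := inZp (if odd x then x./2 + t else x./2).
Let sigV (x : Q) : Q := inZp (if x < t then x.*2 else (x - t).*2.+1).
Let f (x y : Q) : Q := sig (x + y)%R.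
Let g (x y : Q) : Q := (sigV y - x)%R.
Let T : Q := inZp t.
Let tau (x : Q) : Q := (x + T)%R.

Let inZpE n : n < 2 * t -> (inZp n : Q) = n :> nat.
Proof. by move=> nt; rewrite /= modn_small //; move: nt; rewrite /t; lia. Qed.

Let sigE (x : Q) : sig x = (if odd x then x./2 + t else x./2) :> nat.
Proof. by rewrite inZpE //; have hx := ltQ x; case: ifP; lia. Qed.

Let sigVE (x : Q) : sigV x = (if x < t then x.*2 else (x - t).*2.+1) :> nat.
Proof. by rewrite inZpE //; have hx := ltQ x; case: (ltnP x t); lia. Qed.

Let sigK : cancel sig sigV.
Proof.
by move=> x; apply: ord_inj; rewrite sigVE sigE; have hx := ltQ x; case ox: (odd x); case: ltnP => h; lia.
Qed.

Let sigVK : cancel sigV sig.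
Proof.
by move=> x; apply: ord_inj; rewrite sigE sigVE; have hx := ltQ x; case: ltnP => h; case: ifP => h'; lia.
Qed.

Let addE (x y : Q) : (x + y)%R = (if x + y < 2 * t then x + y else x + y - 2 * t) :> nat.
Proof.
have := ltQ x; have := ltQ y; rewrite /=; move: (nat_of_ord x) (nat_of_ord y) => a b hb ha.
have -> : k.*2.+2 = 2 * t by rewrite /t; lia.
case: ltnP => h; first by rewrite modn_small.
by rewrite -{1}(subnK h) modnDr modn_small //; lia.
Qed.

Let tauE (x : Q) : tau x = (if x < t then x + t else x - t) :> nat.
Proof.
rewrite addE inZpE; last by rewrite /t; lia.
by have hx := ltQ x; case: (ltnP x t) => h; case: ltnP => h'; lia.
Qed.

Let fxxE (x : Q) : f x x = (if x < t then x : nat else x - t) :> nat.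
Proof.
rewrite sigE addE; have hx := ltQ x.
by case: (ltnP x t) => h1; case: ltnP => h2; case: ifP; lia.
Qed.

Let fxx (x : Q) : (f x x == x) = (x < t).
Proof. by rewrite -(inj_eq (@ord_inj _)) fxxE; have hx := ltQ x; case: ltnP; lia. Qed.

Let skolemZ := skolem f g tau.

Lemma skolemZ_squag : squag skolemZ.
Proof.
apply: skolem_squag.
- by move=> x y; rewrite /f addrC.
- by move=> x y; rewrite /f /g addrC subrK sigVK.
- by move=> x y; rewrite /f /g sigK addrC addKr.
- move=> x; apply: ord_inj; rewrite !tauE.
  by have hx := ltQ x; case: (ltnP x t) => h; case: ltnP; lia.
- move=> x; rewrite fxx; apply: ord_inj; rewrite fxxE.
  by case: ltnP => // h; rewrite tauE ltnNge h.
- by move=> x; rewrite !fxx tauE; have hx := ltQ x; case: (ltnP x t) => h; lia.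
Qed.

Let TT : (T + T = 0)%R.
Proof.
apply: ord_inj; rewrite addE inZpE; last by rewrite /t; lia.
by rewrite addnn -mul2n ltnn subnn.
Qed.

Let pt (u : nat) (e : bool) : Q := (inZp u + if e then T else 0)%R.

Let ptE u e : u < t -> pt u e = (if e then u + t else u) :> nat.
Proof.
move=> ut; have u2 : u < 2 * t by lia.
rewrite /pt; case: e; first by rewrite -/(tau _) tauE inZpE // ut.
by rewrite addr0 inZpE.
Qed.

(** Adding t = -t to one summand changes the sum like adding it to the other, so
the pairs {x, x + t} of one level span Pasch configurations. *)
Lemma skolem_grid h : 2 * h <= t -> pasch_grid (option (Q * level))%type h.
Proof.
move=> ht; exists skolemZ, (fun u e => Some (pt u e, None)).
exists (fun w e => Some (pt (h + w) e, None)).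
exists (fun u w e => Some (sig (pt u e + inZp (h + w))%R, Some false)).
exists (fun p : option (Q * level) =>
  if p is Some (x, None) then (if x < t then x : nat else x - t) else 2 * h).
have bounds (u w : 'I_h) : [/\ u < h, w < h, u < t & h + w < t].
  by have := ltn_ord u; have := ltn_ord w => hw hu; split; lia.
split.
- exact: skolemZ_squag.
- move=> u w e e'; have [uh wh ut wt] := bounds u w.
  have ne : (pt u e == pt (h + w) e') = false.
    by rewrite -(inj_eq (@ord_inj _)) !ptE //; case: e; case: e'; lia.
  rewrite /skolemZ /= ne; congr (Some (_, _)); rewrite /f; congr (sig _).
  rewrite addrACA [RHS]addrAC; congr (_ + _)%R.
  by case: e e' {ne} => [] []; rewrite ?TT ?addr0 ?add0r ?addr0.
- move=> u; have [_ _ ut _] := bounds u u.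
  by rewrite (inj_eq Some_inj) xpair_eqE eqxx andbT -(inj_eq (@ord_inj _)) !ptE //; lia.
- move=> w; have [_ _ _ wt] := bounds w w.
  by rewrite (inj_eq Some_inj) xpair_eqE eqxx andbT -(inj_eq (@ord_inj _)) !ptE //; lia.
- move=> u w e; have [uh wh ut wt] := bounds u w.
  by rewrite !ptE //; split=> //; case: e; case: ltnP; lia.
Qed.

Lemma dbl_skolem_grid : pasch_grid (option (option (Q * level) * bool))%type t.
Proof.
apply: (@dbl_grid _ skolemZ t (fun u => Some (inZp u, None)) (fun w => Some (inZp (t + w), None))
  (fun p : option (Q * level) => if p is Some (x, None) then x : nat else 2 * t)); first exact: skolemZ_squag.
move=> u w; have := ltn_ord u; have := ltn_ord w => hw hu.
have u2 : u < 2 * t by lia.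
have w2 : t + w < 2 * t by lia.
split; [exact: inZpE|exact: inZpE|].
have ne : (inZp u == inZp (t + w) :> Q) = false.
  by rewrite -(inj_eq (@ord_inj _)) !inZpE //; lia.
by rewrite /skolemZ /skolem eqxx ne.
Qed.

End Skolem.

Section BoseOdd.
Variable k : nat.
Let Q := 'I_(k.*2.+3).
Let half : Q := inZp k.+2.
Let f (x y : Q) : Q := ((x + y) * half)%R.
Let g (x y : Q) : Q := (y + y - x)%R.

Let halfK : (half + half = 1)%R.
Proof.
apply: val_inj; rewrite /= modnDm.
have -> : k.+2 + k.+2 = k.*2.+3 + 1 by lia.
by rewrite modnDl !modn_small.
Qed.

Let f_icq : icq f g.
Proof.
have double x : ((x + x) * half)%R = x by rewrite mulrDl -mulrDr halfK mulr1.
split=> [x|x y|x y|x y]; rewrite /f /g.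
- exact: double.
- by rewrite addrC.
- by rewrite addrC subrK double.
- by rewrite -mulrDr halfK mulr1 addrC addKr.
Qed.

(** For odd q the midpoint quasigroup of Z_q contains no 2 by 2 subsquare. Doubling
it creates one for each pair of distinct elements, and the Bose construction turns
these into Pasch configurations. *)
Lemma bose_grid : pasch_grid (option (Q * bool) * level)%type k.+1.
Proof.
pose a (u : nat) : Q := inZp u.
have aE u : u < k.*2.+3 -> a u = u :> nat by move=> h; rewrite /a /= modn_small.
exists (bose (dbl f) (dbl g)), (fun u e => (Some (a u, e), None)).
exists (fun w e => (Some (a (k.+1 + w), e), None)).
exists (fun u w e => (Some (f (a u) (a (k.+1 + w)), e), Some false)).
exists (fun p : option (Q * bool) * level =>
  if p is (Some (x, _), None) then x : nat else 2 * k.+1).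
have bounds (u w : 'I_k.+1) : [/\ u < k.+1, w < k.+1, u < k.*2.+3 & k.+1 + w < k.*2.+3].
  by have := ltn_ord u; have := ltn_ord w => hw hu; split; lia.
split.
- by apply: bose_squag; apply: dbl_icq; apply: f_icq.
- move=> u w e e'; have [uh wh ut wt] := bounds u w.
  have ne : (a u == a (k.+1 + w)) = false.
    by rewrite -(inj_eq (@ord_inj _)) !aE //; lia.
  rewrite /bose eqxx (inj_eq Some_inj) xpair_eqE ne /=.
  by rewrite /dbl ne.
- by move=> u; rewrite xpair_eqE (inj_eq Some_inj) xpair_eqE eqxx.
- by move=> u; rewrite xpair_eqE (inj_eq Some_inj) xpair_eqE eqxx.
- by move=> u w e; have [uh wh ut wt] := bounds u w; rewrite !aE.
Qed.

End BoseOdd.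

Lemma grid_ord (P : finType) n h : #|P| = n -> pasch_grid P h -> pasch_grid 'I_n h.
Proof. by move=> <-; apply: transport_grid; [apply: enum_rankK|apply: enum_valK]. Qed.

(** Orders 6t + 1 come from the Skolem construction, orders 12t + 3 from doubling
it, and orders 12k + 9 from the Bose construction over a doubled quasigroup of
order 4k + 3. *)
Lemma grid_exists n : 20 <= n -> n %% 6 = 1 \/ n %% 6 = 3 ->
  exists2 h, pasch_grid 'I_n h & n <= 24 * h.
Proof.
move=> n20 [n1|n3].
  pose k := (n %/ 6).-1; exists k.+1./2; last by rewrite /k; lia.
  apply: (grid_ord _ (skolem_grid (k := k) _)); last by lia.
  by rewrite card_option card_prod card_ord card_option card_bool /k; lia.
have [n3'|n9] : n %% 12 = 3 \/ n %% 12 = 9 by lia.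
  pose k := (n %/ 12).-1; exists k.+1; last by rewrite /k; lia.
  apply: (grid_ord _ (dbl_skolem_grid k)).
  rewrite card_option card_prod card_bool card_option card_prod card_ord.
  by rewrite card_option card_bool /k; lia.
pose k := (n %/ 12).-1; exists k.+1; last by rewrite /k; lia.
apply: (grid_ord _ (bose_grid k)).
by rewrite card_prod card_option card_prod card_ord card_option card_bool /k; lia.
Qed.

(** * A switchable system with an excess of one colour *)

Section Relabelling.
Variables (V : finType) (s : {perm V}).

Definition relabel (S : {set {set V}}) : {set {set V}} := [set s @: (T : {set V}) | T in S].

Lemma imset_perm_inj : injective (fun T : {set V} => s @: T).
Proof. exact/imset_inj/perm_inj. Qed.

Lemma relabel_sum (S : {set {set V}}) (w : {set V} -> nat) :
  \sum_(T in relabel S) w T = \sum_(T in S) w (s @: T).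
Proof. by rewrite big_imset //= => T T' _ _; apply: imset_perm_inj. Qed.

Lemma relabel_sts (S : {set {set V}}) : sts S -> sts (relabel S).
Proof.
move=> [cS pS]; split=> [_ /imsetP[T TS ->]|p q pq].
  by rewrite card_imset ?cS //; apply: perm_inj.
rewrite relabel_sum -(pS (s^-1 p)%g (s^-1 q)%g) ?(inj_eq perm_inj) //.
have mem_im x (T : {set V}) : (x \in s @: T) = ((s^-1)%g x \in T).
  by rewrite -{1}(permKV s x) mem_imset //; apply: perm_inj.
by apply: eq_bigr => T _; rewrite !mem_im.
Qed.

Lemma relabel_positives o : positives (map_tuple s o) = [seq s @: T | T : {set V} <- positives o].
Proof.
by move: o; apply: tuple6P => a x b y c z; rewrite !positivesE /= !imsetU !imset_set1.
Qed.

Lemma relabel_switchable (S : {set {set V}}) L :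
  switchable S L -> switchable (relabel S) (map (map_tuple s) L).
Proof.
move=> [hS uL hL dis]; split.
- exact: relabel_sts.
- rewrite map_inj_uniq // => o o' /(congr1 val) /= /(inj_map (@perm_inj _ s)); exact: val_inj.
- move=> _ /mapP[o oL ->]; have [uo sub] := hL _ oL; split.
    by rewrite map_inj_uniq //; apply: perm_inj.
  by move=> T; rewrite relabel_positives => /mapP[T' T'o ->]; apply/imset_f/sub.
- move=> _ _ T /mapP[o oL ->] /mapP[o' oL' ->]; rewrite !relabel_positives.
  case/mapP => T1 h1 -> /mapP[T2 h2 /imset_perm_inj e].
  by rewrite (dis o o' T1) // e.
Qed.

End Relabelling.

(** The multisets of colours have equal size, so if they differ then some colour
is more frequent in the second. *)
Lemma unbalanced_gain r (s1 s2 : seq 'I_r) : size s1 = size s2 -> ~~ perm_eq s1 s2 ->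
  exists i, count_mem i s1 < count_mem i s2.
Proof.
move=> sz np; case: (boolP [exists i, count_mem i s1 < count_mem i s2]) => [/existsP //|].
rewrite negb_exists => /forallP le; case/negP: np.
have size_count (s : seq 'I_r) : size s = \sum_i count_mem i s.
  rewrite -sum1_size; under [RHS]eq_bigr do rewrite -sum1_count big_mkcond.
  rewrite exchange_big /=; apply: eq_bigr => x _.
  by rewrite (bigD1 x) //= eqxx big1 // => i; rewrite eq_sym => /negPf ->.
have e i : count_mem i s2 = count_mem i s1.
  have le' j : count_mem j s2 <= count_mem j s1 by rewrite leqNgt.
  move: sz; rewrite !size_count (bigD1 i) //= [in RHS](bigD1 i) //= => sz.
  have := le' i; have : \sum_(j | j != i) count_mem j s2 <= \sum_(j | j != i) count_mem j s1.
    by apply: leq_sum => j _.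
  move: sz; move: (\sum_(j | j != i) count_mem j s1) (\sum_(j | j != i) count_mem j s2) => a b.
  by move: (count_mem i s1) (count_mem i s2) => x y; lia.
by apply/allP => i _ /=; rewrite e.
Qed.

Lemma pigeonhole_colour r (T : Type) (L : seq T) (g : 'I_r -> pred T) :
  0 < r -> all (fun o => [exists i, g i o]) L -> exists i, size L <= r * count (g i) L.
Proof.
move=> r0; rewrite all_count => /eqP <-.
have [i _ hi] : exists2 i : 'I_r, true & forall j, count (g j) L <= count (g i) L.
  by case: (arg_maxnP (fun i => count (g i) L) (P := predT) (i0 := Ordinal r0)) => // i _ hi;
    exists i => // j; apply: hi.
exists i; apply: (@leq_trans (\sum_(j < r) count (g j) L)); last first.
  by rewrite -[X in X * _]card_ord -sum_nat_const; apply: leq_sum.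
rewrite -sum1_count; under [leqRHS]eq_bigr do rewrite -sum1_count big_mkcond.
rewrite exchange_big big_mkcond /=; apply: leq_sum => o _.
by case: existsP => // -[j gj]; rewrite (bigD1 j) //= gj.
Qed.

Lemma colour_sum (V : finType) r (S : {set {set V}}) (col : {set V} -> 'I_r) :
  \sum_i \sum_(T in S) (col T == i) = #|S|.
Proof.
rewrite exchange_big /= -sum1_card; apply: eq_bigr => T _.
by rewrite (bigD1 (col T)) //= eqxx big1 // => i; rewrite eq_sym => /negPf ->.
Qed.

(** If no system exceeds the share of any colour by much, then none stays below it
by much, because the other colours cannot absorb the rest. So each colour takes at
least 1/2r of every relabelling of S0, hence of all triples. *)
Lemma dense_colours n r K (col : {set 'I_n} -> 'I_r) (S0 : {set {set 'I_n}}) :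
  2 < r -> 8 * r <= K -> 6 <= n -> sts S0 ->
  (forall (S : {set {set 'I_n}}) i, sts S -> K * (3 * r * \sum_(T in S) (col T == i)) < K * 'C(n, 2) + n ^ 2) ->
  (forall (S : {set {set 'I_n}}) i, sts S -> K * 'C(n, 2) <=
     K * (3 * r * \sum_(T in S) (col T == i)) + r.-1 * n ^ 2) /\
  (forall i, n ^ 3 <= 4 * r * #|[set t : 3.-tuple 'I_n | uniq t & col [set x in t] == i]|).
Proof.
move=> r3 K8 n6 hS0 neg.
have card3 (S : {set {set 'I_n}}) : sts S -> 'C(n, 2) = 3 * #|S|.
  by move=> /sts_card; rewrite card_ord bin2; lia.
have low (S : {set {set 'I_n}}) i : sts S -> K * 'C(n, 2) <=
     K * (3 * r * \sum_(T in S) (col T == i)) + r.-1 * n ^ 2.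
  move=> hS; have tot := colour_sum S col; rewrite (bigD1 i) //= in tot.
  have : \sum_(j | j != i) K * (3 * r * \sum_(T in S) (col T == j)) <=
      \sum_(j < r | j != i) (K * 'C(n, 2) + n ^ 2).
    by apply: leq_sum => j _; apply/ltnW/neg.
  rewrite sum_nat_const -!big_distrr /= cardC1 card_ord.
  move: tot; rewrite (card3 S hS).
  move: (\sum_(T in S) (col T == i)) (\sum_(j | j != i) _) => a b.
  move=> <-; move: r3 => {neg card3 hS0 col S hS}; case: r K8 i => // r' _ _ _ /=.
  by nia.
split=> // i.
have c3 := card3 _ hS0.
have d : #|[set t : 3.-tuple 'I_n | uniq t]| <=
    2 * r * #|[set t : 3.-tuple 'I_n | uniq t & col [set x in t] == i]|.
  apply: (@colour_density _ S0 (fun T => col T == i)).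
  - by case: hS0.
  - have : 0 < 'C(n, 2) by rewrite bin_gt0; lia.
    by rewrite c3; case: #|S0|.
  move=> s; have := low _ i (relabel_sts s hS0); rewrite relabel_sum c3.
  have : n * n <= 12 * #|S0| by have := sts_card hS0; rewrite card_ord; nia.
  move: (\sum_(T in S0) _) #|S0| => W m nm.
  rewrite -mulnn => h.
  have h1 : r.-1 * (n * n) <= 12 * r * m by nia.
  have h2 : 24 * r * m <= 3 * K * m by nia.
  have h3 : K * (3 * m) <= K * (6 * r * W) by nia.
  by have := h3; rewrite leq_pmul2l; lia.
have u3 : #|[set t : 3.-tuple 'I_n | uniq t]| = n * n.-1 * n.-2.
  rewrite (_ : [set t : 3.-tuple 'I_n | uniq t] = [set t : 3.-tuple 'I_n | all predT t & uniq t]).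
    by rewrite card_uniq_tuples card_ord !ffactnS ffactn0 muln1 mulnA.
  by apply/setP => t; rewrite !inE all_predT.
rewrite u3 in d.
have : n ^ 3 <= 2 * (n * n.-1 * n.-2) by nia.
by lia.
Qed.

(** The bound on mu in integers: C(n, 2) is three times the number of triples. In
K, 576 = 24^2 compares n^2 with the number of configurations, D with those that are
unbalanced, r with those that gain for one colour, and the factor 8 makes
[dense_colours] applicable. *)
Lemma excess_system r : 2 < r -> exists K N, 0 < K /\ forall n, N <= n ->
  n %% 6 = 1 \/ n %% 6 = 3 -> forall col : {set 'I_n} -> 'I_r,
  exists (S : {set {set 'I_n}}) i, sts S /\
    K * 'C(n, 2) + n ^ 2 <= K * (3 * r * \sum_(T in S) (col T == i)).
Proof.
move=> r3; have [D [N0 unb]] := many_unbalanced 'I_r (4 * r).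
pose K := 8 * r * D.+1 * 576; exists K, (N0 + 20); split.
  by rewrite /K !muln_gt0 /=; lia.
move=> n nN nmod col; apply: boolp.contrapT => none.
have neg (S : {set {set 'I_n}}) i : sts S ->
    K * (3 * r * \sum_(T in S) (col T == i)) < K * 'C(n, 2) + n ^ 2.
  by move=> hS; rewrite ltnNge; apply/negP => h; apply: none; exists S, i.
have [h grid nh] : exists2 h, pasch_grid 'I_n h & n <= 24 * h by apply: grid_exists; lia.
have [S0 [L [sw szL]]] := grid_switchable grid.
have [hS0 _ hL _] := sw.
have K8 : 8 * r <= K by rewrite /K -[X in _ <= X]mulnA leq_pmulr // muln_gt0.
have [low dens] := dense_colours r3 K8 (ltac:(lia) : 6 <= n) hS0 neg.
pose three (c : 'I_3) : 'I_r := widen_ord r3 c.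
have three_inj : injective three by move=> c c' /(congr1 val) /= /val_inj.
have cardn : #|'I_n| = n by rewrite card_ord.
have := unb _ col three; rewrite cardn => /(_ ltac:(lia) three_inj (fun c => dens _)).
set Bad := [set o | _] => manybad.
have [s hs] := @good_relabelling _ 6 L Bad (fun o oL => (hL o oL).1)
  (fun o oB => ltac:(by move: oB; rewrite inE => /andP[])).
pose L1 := [seq o <- map (map_tuple s) L | o \in Bad].
have [hS1 uL1 hL1 dis1] := relabel_switchable s sw.
set S1 := relabel s S0 in hS1 hL1.
have szL1 : size L <= D * size L1.
  have n0 : 0 < n ^ 6 by rewrite expn_gt0; lia.
  rewrite -(leq_pmul2r n0) size_filter count_map.
  apply: leq_trans (leq_mul (leqnn _) manybad) _.
  rewrite cardn in hs; rewrite mulnCA -mulnA leq_mul2l; apply/orP; right; exact: hs.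
pose gain i (o : 6.-tuple 'I_n) := \sum_(T <- positives o) (col T == i) <
  \sum_(T <- negatives o) (col T == i).
have gainP : all (fun o => [exists i, gain i o]) L1.
  apply/allP => o; rewrite mem_filter inE => /andP[/andP[_ ub] _].
  have sum_count i (l : seq {set 'I_n}) : \sum_(T <- l) (col T == i) = count_mem i (map col l).
    rewrite count_map -sum1_count [RHS]big_mkcond /=.
    by apply: eq_bigr => T _; case: (_ == _).
  have [|i hi] := unbalanced_gain _ ub.
    by rewrite !size_map; move: o {ub}; apply: tuple6P.
  by apply/existsP; exists i; rewrite /gain !sum_count.
have [i hi] := pigeonhole_colour (ltnW (ltnW r3)) gainP.
pose L2 := [seq o <- L1 | gain i o].
have sub2 : {subset L2 <= map (map_tuple s) L}.
  by move=> o; rewrite !mem_filter => /and3P[].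
have [||||S2 hS2 W2] := @switch_all _ (fun T => col T == i : nat) L2 S1 hS1.
- by rewrite !filter_uniq.
- by move=> o /sub2 /hL1.
- by move=> o o' T /sub2 ? /sub2 ?; apply: dis1.
- by move=> o; rewrite mem_filter => /andP[].
have b2 := neg _ i hS2; have b1 := low _ i hS1.
rewrite -size_filter -/L2 in hi.
have big : n ^ 2 <= K * size L2.
  apply: (@leq_trans (576 * size L)).
    by rewrite szL -[576]/(24 ^ 2) -expnMn leq_exp2r.
  have -> : K * size L2 = 8 * (576 * (D.+1 * (r * size L2))) by rewrite /K; ring.
  apply: leq_trans (leq_pmull _ _) => //; rewrite leq_mul //.
  apply: leq_trans szL1 _; apply: leq_mul => //.
have gain2 : K * (3 * r * \sum_(T in S1) (col T == i)) + 3 * (r * (K * size L2)) <=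
    K * (3 * r * \sum_(T in S2) (col T == i)).
  move: (\sum_(T in S1) _) (\sum_(T in S2) _) W2 => x y W2.
  apply: leq_trans (_ : K * (3 * r * (x + size L2)) <= _); last by rewrite !leq_mul.
  by rewrite leq_eqVlt; apply/orP; left; apply/eqP; ring.
have rbig : r * n ^ 2 <= r * (K * size L2) by rewrite leq_mul.
have r_eq : r * n ^ 2 = r.-1 * n ^ 2 + n ^ 2 by rewrite -{1}(ltn_predK r3) mulSn addnC.
move: b1 b2 r_eq gain2 rbig; move: (K * (_ * \sum_(T in S1) _)) (K * (_ * \sum_(T in S2) _)).
move: (r.-1 * n ^ 2) (r * n ^ 2) (n ^ 2) (r * (K * size L2)) (K * 'C(n, 2)).
by clear; lia.
Qed.

(** * The theorem *)

Import Order.TTheory GRing.Theory Num.Theory.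
Local Open Scope ring_scope.

Lemma sts_triples n (S : {set {set 'I_n}}) : sts S ->
  steiner_triple_system [set T : triple n | val T \in S].
Proof.
move=> hS P cP; have /cards2P[p [q [pq ->]]] : #|P| == 2%N by rewrite cP.
have := hS.2 p q pq.
case: (boolP [exists T in S, (p \in T) && (q \in T)]) => [|none]; last first.
  rewrite negb_exists in none; move/forallP: none => none.
  by rewrite big1 // => T TS; have := none T; rewrite TS /=; case: (_ && _).
case/exists_inP => T TS /andP[pT qT] _.
have cT : #|T| == 3 by rewrite hS.1.
exists (exist _ T cT); split.
  by rewrite inE /= TS; split=> //; apply/subsetP => v; rewrite !inE => /orP[] /eqP ->.
move=> T' [T'S /subsetP sub]; apply: val_inj => /=; rewrite inE in T'S.
by apply: (sts_uniq hS pq) => //; apply: sub; rewrite !inE eqxx ?orbT.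
Qed.

Theorem theorem1p3 (R : realType) (r : nat) (hr : (3 <= r)%N) :
  exists2 mu : R, 0 < mu &
    exists N : nat, forall n : nat, (N <= n)%N ->
      (n %% 6 = 1 \/ n %% 6 = 3)%N ->
      forall c : triple n -> 'I_r,
      exists S : {set triple n}, steiner_triple_system S /\
        exists i : 'I_r,
          1 / r%:R * (1 / 3%:R) * ('C(n, 2))%:R + mu * n%:R ^+ 2
            <= #|[set T in S | c T == i]|%:R.
Proof.
have [K [N [K0 excess]]] := excess_system hr.
have r0 : 0 < r%:R :> R by rewrite ltr0n (leq_trans _ hr).
have K0' : 0 < K%:R :> R by rewrite ltr0n.
exists (1 / (3%:R * r%:R * K%:R)); first by rewrite divr_gt0 // !mulr_gt0 // ltr0n.
exists N => n nN nmod c.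
pose i0 : 'I_r := Ordinal (leq_trans (isT : (0 < 3)%N) hr).
pose col (T : {set 'I_n}) := if insub T is Some t then c t else i0.
have [S [i [hS large]]] := excess n nN nmod col.
exists [set T : triple n | val T \in S]; split; first exact: sts_triples.
exists i.
have cnt : (\sum_(T in S) (col T == i) <=
    #|[set T in [set T : triple n | val T \in S] | c T == i]|)%N.
  rewrite -(card_imset _ val_inj) -sum1_card [leqRHS]big_mkcond [leqLHS]big_mkcond /=.
  apply: leq_sum => T _; case: (boolP (T \in S)) => // TS.
  have cT : #|T| == 3 by rewrite hS.1.
  rewrite /col insubT; case: eqP => // /eqP cTi.
  by rewrite (_ : T = val (exist _ T cT : triple n)) // imset_f // !inE /= TS.
have : (K * 'C(n, 2) + n ^ 2 <=
    K * (3 * r * #|[set T in [set T : triple n | val T \in S] | c T == i]|))%N.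
  by apply: leq_trans large _; rewrite !leq_mul.
rewrite -(ler_nat R) natrD natrX !natrM => le.
have pos : 0 < 3%:R * r%:R * K%:R :> R by rewrite !mulr_gt0 // ltr0n.
rewrite -(ler_pM2l pos).
have -> : 3%:R * r%:R * K%:R * (1 / r%:R * (1 / 3%:R) * 'C(n, 2)%:R +
    1 / (3%:R * r%:R * K%:R) * n%:R ^+ 2) = K%:R * 'C(n, 2)%:R + n%:R ^+ 2 :> R.
  by field; rewrite !gt_eqF.
by apply: le_trans le _; rewrite le_eqVlt; apply/orP; left; apply/eqP; ring.
Qed.
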